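(* Let $0<\alpha<2$, $\beta>0$, and $Q(dx)=x^{-1-\beta}dx$ on $\mathbb R_+=(0,\infty)$. Let $g\in L^\alpha([0,2\pi),\mathrm{Leb})$ be real-valued, extended $2\pi$-periodically to $\mathbb R$, and suppose that $$\int_0^{2\pi}|g(s+t)-g(s)|^\alpha\,ds=O(|t|^{r})\qquad(t\to0)$$ for some $r>\beta$. Then the process $$X_t=\int_{[0,2\pi)\times\mathbb R_+}\left[g(s+tx)-g(s)\right]M(ds,dx),\qquad t\in\mathbb R,$$ where $M$ is an independently scattered $S\alpha S$ random measure on $[0,2\pi)\times\mathbb R_+$ with control measure $\mathrm{Leb}\otimes Q$, is well-defined and $H$-self-similar with $H=\beta/\alpha$.
   Context: An independently scattered $S\alpha S$ random measure $M$ with control measure $\mu$ satisfies $E\exp\{i\theta M(A)\}=\exp\{-|\theta|^\alpha\mu(A)\}$ for $\mu(A)<\infty$; $\int f\,dM$ is well-defined iff $f\in L^\alpha(\mu)$. $H$-self-similar means $\{X(\lambda t),t\in\mathbb R\}\stackrel{d}{=}\{\lambda^HX(t),t\in\mathbb R\}$ for every $\lambda>0$ (equality of finite-dimensional distributions). *)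

(* Defs.v *)
From HB Require Import structures.
From mathcomp Require Import all_boot all_order all_algebra.
From mathcomp Require Import all_classical all_reals all_analysis.
From mathcomp Require Import measurable_realfun.

Set Implicit Arguments.
Unset Strict Implicit.
Unset Printing Implicit Defensive.
Import Order.TTheory GRing.Theory Num.Theory.
Import numFieldNormedType.Exports HBSimple.

Local Open Scope classical_set_scope.
Local Open Scope ring_scope.

Section power_measure.
Context {R : realType}.
Variable beta : R.
Local Open Scope ereal_scope.

(* The measure x^(-1-beta) dx on (0, +oo), seen as a measure on R that gives
   no mass to ]-oo, 0]. *)
Definition power_measure (A : set (measurableTypeR R)) : \bar R :=
  \int[lebesgue_measure]_(x in A `&` `]0%R, +oo[) (x `^ (-1 - beta))%:E.

Let f : R -> \bar R :=
  (fun x : R => (x `^ (-1 - beta))%:E) \_ `]0%R, +oo[.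

Let f0 x : 0 <= f x.
Proof. by rewrite /f patchE; case: ifP => // _; rewrite lee_fin powR_ge0. Qed.

Let mf : measurable_fun [set: R] f.
Proof.
apply/(measurable_restrictT _ _).1 => //.
apply/measurable_EFinP; apply: measurable_funTS; exact: measurable_powR.
Qed.

Let power_measureE A : power_measure A = \int[lebesgue_measure]_(x in A) f x.
Proof. by rewrite /power_measure integral_mkcondr. Qed.

Let power_measure0 : power_measure set0 = 0.
Proof. by rewrite power_measureE integral_set0. Qed.

Let power_measure_ge0 A : 0 <= power_measure A.
Proof. by rewrite power_measureE; apply: integral_ge0. Qed.

Let power_measure_sigma_additive : semi_sigma_additive power_measure.
Proof.
rewrite (_ : power_measure = fun A => \int[lebesgue_measure]_(x in A) f x).
  exact: semi_sigma_additive_nng_induced.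
by apply/funext => A; exact: power_measureE.
Qed.

HB.instance Definition _ := isMeasure.Build _ _ _ power_measure
  power_measure0 power_measure_ge0 power_measure_sigma_additive.

Let power_measure_sigma_finite : sigma_finite setT power_measure.
Proof.
pose F n : set R := `[(- n%:R)%R, n%:R%R] `&` [set x | f x <= n%:R%:E].
exists F.
  apply/esym; rewrite -subTset => x _.
  have [y fy] : exists y : R, f x = y%:E.
    by rewrite /f patchE; case: ifP => _; eexists.
  have bnd (z : R) m : (Num.bound `|z| <= m)%N -> (`|z| <= m%:R)%R.
    move=> zm; apply: le_trans (ltW (archi_boundP (normr_ge0 z))) _.
    by rewrite ler_nat.
  exists (maxn (Num.bound `|x|) (Num.bound `|y|)) => //; split => /=.
    by rewrite in_itv/= -ler_norml bnd// leq_maxl.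
  by rewrite fy lee_fin (le_trans (ler_norm _))// bnd// leq_maxr.
move=> n; have mF : measurable (F n).
  apply: measurableI; first exact: measurable_itv.
  by rewrite -[X in measurable X]setTI; exact: emeasurable_fun_infty_c.
split => //; rewrite power_measureE.
apply: (@le_lt_trans _ _ (\int[lebesgue_measure]_(x in F n) n%:R%:E)).
  by apply: ge0_le_integral => //;
    [exact: measurable_funTS|move=> x [_ /=]].
rewrite integral_cst// lte_mul_pinfty// (@le_lt_trans _ _
  (lebesgue_measure (`[(- n%:R)%R, n%:R%R] : set R)))//.
  by rewrite le_measure ?inE//; apply: subIsetl.
by rewrite lebesgue_measure_itv/=; case: ifP => _; rewrite ?ltry// -EFinB ltry.
Qed.

HB.instance Definition _ := Measure_isSigmaFinite.Build _ _ _ power_measure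
  power_measure_sigma_finite.

End power_measure.
Arguments power_measure {R} beta.

Section random_measure.
Context {R : realType} d (Omega : measurableType d) (P : probability Omega R).

(* E exp(i theta Y) = exp(-|theta|^alpha c), split into real and imaginary
   parts; the scale parameter of Y is c^(1/alpha). *)
Definition SaS (alpha c : R) (Y : {RV P >-> R}) :=
  forall theta : R,
    ('E_P[fun w => cos (theta * Y w)%R] = (expR (- (`|theta| `^ alpha * c)))%:E)%E
    /\ ('E_P[fun w => sin (theta * Y w)%R] = 0)%E.

(* Subfamilies are covered by taking B i = setT. *)
Definition independent_RVs n (Y : 'I_n -> {RV P >-> R}) :=
  forall B : 'I_n -> set R, (forall i, measurable (B i)) ->
    P (\bigcap_i (Y i @^-1` B i)) = (\prod_(i < n) P (Y i @^-1` B i))%E.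

Definition cvg_in_probability (Y_ : nat -> Omega -> R) (Y : Omega -> R) :=
  forall eps : R, 0 < eps ->
    P [set w | eps <= `|Y_ n w - Y w|] @[n --> \oo] --> 0%E.

Context d' (T : measurableType d') (D : set T) (mu : {measure set T -> \bar R}).
Variable alpha : R.

(* A random measure on D with control measure mu is indexed by all sets of T,
   but its value is meaningful only on finite_subsets. *)
Definition finite_subsets : set (set T) :=
  [set A | [/\ measurable A, A `<=` D & (mu A < +oo)%E]].

Record SaS_random_measure (M : set T -> {RV P >-> R}) : Prop := {
  random_measure_sigma_additive : forall A : nat -> set T,
    (forall k, finite_subsets (A k)) -> trivIset setT A ->
    finite_subsets (\bigcup_k A k) ->
    {ae P, forall w, \sum_(0 <= k < n) M (A k) w @[n --> \oo] -->
                     M (\bigcup_k A k) w} ;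
  random_measure_independently_scattered : forall n (A : 'I_n -> set T),
    (forall i, finite_subsets (A i)) -> trivIset setT A ->
    independent_RVs (M \o A) ;
  random_measure_SaS : forall A, finite_subsets A ->
    SaS alpha (fine (mu A)) (M A) }.

Variable M : set T -> {RV P >-> R}.

Definition integrable_simple (f : {sfun T >-> R}) :=
  forall y : R, y != 0 -> finite_subsets (f @^-1` [set y]).

Definition simple_stable_integral (f : {sfun T >-> R}) (w : Omega) : R :=
  \sum_(y \in range f `\ 0) y * M (f @^-1` [set y]) w.

(* Y is (a version of) the integral of f over D with respect to M: a limit in
   probability of integrals of simple functions tending to f in
   L^alpha(D, mu). *)
Definition is_stable_integral (f : T -> R) (Y : {RV P >-> R}) :=
  (f \_ D) \in Lfun mu alpha%:E /\
  exists f_ : nat -> {sfun T >-> R},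
    [/\ forall n, integrable_simple (f_ n),
        (\int[mu]_(x in D) (`|f_ n x - f x| `^ alpha)%:E)%E @[n --> \oo] --> 0%E &
        cvg_in_probability (fun n => simple_stable_integral (f_ n)) Y].

Definition stable_integral_well_defined (f : T -> R) :=
  [/\ (f \_ D) \in Lfun mu alpha%:E,
      exists Y, is_stable_integral f Y &
      forall Y Z, is_stable_integral f Y -> is_stable_integral f Z ->
        {ae P, forall w, Y w = Z w}].

End random_measure.

Section self_similar.
Context {R : realType} d (Omega : measurableType d) (P : probability Omega R).

Definition finite_dim_distribution (X : R -> Omega -> R) n (t : n.-tuple R) :
    set (n.-tuple R) -> \bar R :=
  pushforward P (fun w => [tuple X (tnth t i) w | i < n]).

Definition same_finite_dim_distributions (X Y : R -> Omega -> R) :=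
  forall n (t : n.-tuple R) (B : set (n.-tuple R)), measurable B ->
    finite_dim_distribution X t B = finite_dim_distribution Y t B.

Definition self_similar (H : R) (X : R -> Omega -> R) :=
  forall lambda : R, 0 < lambda ->
    same_finite_dim_distributions (fun t => X (lambda * t))
                                  (fun t w => lambda `^ H * X t w).

End self_similar.

Section increment_process.
Context {R : realType}.

Definition strip : set (measurableTypeR R * measurableTypeR R) :=
  `[0, 2 * pi[ `*` `]0, +oo[.

(* Carried by R x (0, +oo); its restriction to the subsets of the strip is the
   control measure Leb (x) Q, and only these values are used. *)
Definition strip_measure (beta : R) :
    {measure set (measurableTypeR R * measurableTypeR R) -> \bar R} :=
  (@lebesgue_measure R \x power_measure beta)%E.

Definition increment (g : R -> R) (t : R)
    (sx : measurableTypeR R * measurableTypeR R) : R :=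
  g (sx.1 + t * sx.2) - g sx.1.

End increment_process.

(* Main.v *)
Require Import Defs.
From HB Require Import structures.
From mathcomp Require Import all_boot all_order all_algebra.
From mathcomp Require Import finmap.
From mathcomp Require Import all_classical all_reals all_analysis.
From mathcomp Require Import ring lra measurable_realfun.

Set Implicit Arguments.
Unset Strict Implicit.
Unset Printing Implicit Defensive.
Import Order.TTheory GRing.Theory Num.Theory.
Import numFieldNormedType.Exports HBSimple HBNNSimple.

Local Open Scope classical_set_scope.
Local Open Scope ring_scope.

(* A stable integral of f has characteristic function
   theta |-> exp (-|theta|^alpha N f), where N f is the integral of |f|^alpha.
   A stable variable with N f = 0 vanishes almost surely, and an explicit tail
   bound makes integrals of an L^alpha-Cauchy sequence of simple functions
   Cauchy in probability, so the integral exists and is unique on L^alpha.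
   By Tonelli, the modular of the t-increment is the integral of
   Phi (t x) x^(-1-beta) over x > 0, where Phi u is the integral of
   |g (s + u) - g s|^alpha over a period: Phi is bounded, and it is O(|u|^r) at
   0 with r > beta.
   Finally the (lambda t)-increment at (s, x) is the t-increment at
   (s, lambda x), and Q scales by lambda^beta under dilation; so a linear
   combination of the X (lambda t_i) has scale lambda^beta times that of the
   same combination of the X (t_i), and the finite-dimensional distributions
   agree because they are determined by their characteristic functions. *)

(** * Characteristic functions determine distributions on R^n *)

(** No single triangle inequality covers [0 < alpha < 2]: the [L^alpha] norm serves for
    [alpha >= 1], its power [alpha] for [alpha <= 1]. Estimates therefore use [N (f + g) <= (1 +
    delta)^alpha N f + (1 + 1/delta)^alpha N g]: [delta = 1] gives finiteness, small [delta] gives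
    continuity of N. Characteristic functions are handled with no inversion formula. Real
    trigonometric polynomials form an algebra, and its closure under bounded pointwise limits
    contains the indicator of every Borel set, so equal expectations on the algebra give equal laws.
    Independence is given only as a product formula for events. To reach cosines and sines, the sum
    is built one variable at a time while the remaining variables are kept as events. For existence,
    the tail bound costs at most a factor of order [4^n] at level [2^-n], because [alpha < 2]; a
    subsequence with modulars below [8^-n] beats it. Integrals against Q are estimated on dyadic
    shells, whose masses are geometric by the dilation rule. *)

Section bounded_integrals.
Context {R : realType} d (Omega : measurableType d) (P : probability Omega R).
Implicit Types f g : Omega -> R.

Lemma bounded_integrable f (K : R) : measurable_fun setT f ->
  (forall w, `|f w| <= K) -> P.-integrable setT (EFin \o f).
Proof.
move=> mf fK; apply: measurable_bounded_integrable => //.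
  by rewrite -ge0_fin_numE ?fin_num_measure.
exists K; split; first by rewrite num_real.
by move=> x Kx w _ /=; rewrite (le_trans (fK w))// ltW.
Qed.

Lemma bounded_expectationE f (K : R) : measurable_fun setT f ->
  (forall w, `|f w| <= K) -> ('E_P[f] = (\int[P]_w f w)%R%:E)%E.
Proof.
move=> mf fK; rewrite unlock /Rintegral fineK//.
by apply: integrable_fin_num => //; exact: bounded_integrable fK.
Qed.

Lemma bounded_cvg_Rintegral (f_ : nat -> Omega -> R) f (K : R) :
  (forall n, measurable_fun setT (f_ n)) -> (forall n w, `|f_ n w| <= K) ->
  (forall w, f_ n w @[n --> \oo] --> f w) ->
  (\int[P]_w f_ n w)%R @[n --> \oo] --> (\int[P]_w f w)%R.
Proof.
move=> mf_ f_K f_f.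
have mf : measurable_fun setT f.
  by apply: (measurable_fun_cvg mf_) => w _; exact: f_f.
have [|||||iF _ cv] := @dominated_convergence _ _ _ P setT measurableT
  (fun n => EFin \o f_ n) (EFin \o f) (cst K%:E).
- by move=> n; apply/measurable_EFinP.
- exact/measurable_EFinP.
- by apply/aeW => w _; apply/cvg_EFin; [exact: nearW|exact: f_f].
- exact: (bounded_integrable (measurable_cst K) (fun _ => lexx `|K|)).
- by apply/aeW => w n _; rewrite /= lee_fin.
have fn : (\int[P]_w (EFin \o f) w)%E \is a fin_num by exact: integrable_fin_num.
by apply: fine_cvg; rewrite /Rintegral fineK.
Qed.

End bounded_integrals.

Section smoothstep.
Context {R : realType}.

(* Iterating an odd polynomial fixing -1, 0, 1 and pushing ]0, 1] towards 1
   approximates the sign function on [-1, 1]. *)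
Definition smoothstep (x : R) : R := (3 * x - x ^+ 3) / 2.

(** [1 - smoothstep y = (1 - y)^2 (2 + y) / 2] and [1 + smoothstep y = (1 + y)^2 (2 - y) / 2] are
    both nonnegative on [[-1, 1]]. *)
Lemma smoothstep_bound n x : `|x| <= 1 -> `|iter n smoothstep x| <= 1.
Proof.
move=> x1; elim: n => [//|n]; rewrite iterS /smoothstep.
move: (iter _ _ _) => y; rewrite !ler_norml => /andP[y1 y2].
have ? : 0 <= (1 - y) ^+ 2 * (2 + y) by rewrite mulr_ge0 ?sqr_ge0//; lra.
have ? : 0 <= (1 + y) ^+ 2 * (2 - y) by rewrite mulr_ge0 ?sqr_ge0//; lra.
by apply/andP; split; nra.
Qed.

Lemma smoothstepN n x : iter n smoothstep (- x) = - iter n smoothstep x.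
Proof. by elim: n => [//|n IH]; rewrite !iterS IH /smoothstep; field. Qed.

(** The iterates never fall below [x], because [smoothstep y - y = y (1 - y^2) / 2]. Each step
    multiplies the distance to 1 by [1 - (y + y^2) / 2], which is then at most [1 - x / 2]. *)
Lemma smoothstep_cvg_gt0 x : 0 < x <= 1 -> iter n smoothstep x @[n --> \oo] --> (1 : R).
Proof.
move=> /andP[x0 x1].
have H n : x <= iter n smoothstep x <= 1 /\ 1 - iter n smoothstep x <= (1 - x / 2) ^+ n.
  elim: n => [|n]; first by rewrite /= lexx x1 expr0; split=> //; lra.
  rewrite iterS exprS /smoothstep; move: (iter _ _ _) => y [/andP[xy y1]] E.
  have ? : 0 <= (1 - y) ^+ 2 * (2 + y) by rewrite mulr_ge0 ?sqr_ge0//; lra.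
  have ? : 0 <= y * (1 - y ^+ 2) by rewrite mulr_ge0 ?subr_ge0 ?expr_le1//; lra.
  split; first by apply/andP; split; nra.
  have -> : 1 - (3 * y - y ^+ 3) / 2 = (1 - (y + y ^+ 2) / 2) * (1 - y) by field.
  by apply: ler_pM => //; nra.
rewrite (_ : (fun n => _) = fun n => 1 - (1 - iter n smoothstep x)); last first.
  by apply/funext => n; rewrite opprB addrC subrK.
rewrite -[X in _ --> X]subr0; apply: cvgB; first exact: cvg_cst.
apply: (squeeze_cvgr (f := fun=> 0) (h := fun n => (1 - x / 2) ^+ n)).
- by apply: nearW => n; have [/andP[_ ?] ->] := H n; rewrite subr_ge0 andbT.
- exact: cvg_cst.
- by apply: cvg_expr; rewrite ger0_norm; lra.
Qed.

Lemma smoothstep_cvg x : `|x| <= 1 -> iter n smoothstep x @[n --> \oo] --> Num.sg x.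
Proof.
rewrite ler_norml => /andP[x1 x2]; case: sgrP => [->|x0|x0].
- rewrite (_ : (fun n => _) = fun=> 0); first exact: cvg_cst.
  by apply/funext; elim=> [//|n IH]; rewrite iterS IH /smoothstep; field.
- by apply: smoothstep_cvg_gt0; rewrite x0 x2.
- rewrite -[x]opprK; under eq_fun do rewrite smoothstepN.
  by apply: cvgN; apply: smoothstep_cvg_gt0; apply/andP; split; lra.
Qed.
End smoothstep.

Lemma near_natS_gt {R : realType} (a : R) : \forall k \near \oo, a < k.+1%:R.
Proof.
near=> k; apply: (@lt_trans _ _ k%:R); last by rewrite ltr_nat.
by near: k; exact: nbhs_infty_gtr.
Unshelve. all: by end_near.
Qed.

(** * Closure of a function algebra under bounded pointwise limits *)

Section bounded_closure.
Context {R : realType} (T : Type) (A : set (T -> R)).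

(** The uniform bound [K] is what dominated convergence asks for. The inductive form lets any
    property stable under such limits be proved by induction on membership. *)
Inductive bounded_closure : (T -> R) -> Prop :=
| bounded_closure_base f : A f -> bounded_closure f
| bounded_closure_lim (f_ : nat -> T -> R) (f : T -> R) (K : R) :
    (forall n, bounded_closure (f_ n)) -> (forall n x, `|f_ n x| <= K) ->
    (forall x, f_ n x @[n --> \oo] --> f x) -> bounded_closure f.

Hypothesis A_bounded : forall f, A f -> exists K : R, forall x, `|f x| <= K.
Hypothesis A_lin : forall (k : R) f g, A f -> A g -> A (fun x => k * f x + g x).
Hypothesis A_mul : forall f g, A f -> A g -> A (fun x => f x * g x).

Lemma bounded_closure_bounded f : bounded_closure f ->
  exists K : R, forall x, `|f x| <= K.
Proof.
elim=> [g /A_bounded//|f_ g K _ _ f_K f_g]; exists K => x.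
apply: (cvgr_to_le (cvg_norm (f_g x))); exact: nearW.
Qed.

(** Induction on [f] for all [g], with an inner induction on [g] when [f] is in [A]. The boundedness
    of the other argument keeps the approximations uniformly bounded. *)
Lemma bounded_closure_op (op : R -> R -> R) :
  (forall f g, A f -> A g -> A (fun x => op (f x) (g x))) ->
  (forall K L : R, exists M : R, forall a b,
     `|a| <= K -> `|b| <= L -> `|op a b| <= M) ->
  (forall a b (a_ b_ : nat -> R), a_ n @[n --> \oo] --> a -> b_ n @[n --> \oo] --> b ->
     op (a_ n) (b_ n) @[n --> \oo] --> op a b) ->
  forall f g, bounded_closure f -> bounded_closure g ->
  bounded_closure (fun x => op (f x) (g x)).
Proof.
move=> Aop op_bounded op_cvg f g cf; elim: cf g => {f} [f Af g|f_ f K cf_ IH f_K f_f g cg].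
  have [K fK] := A_bounded Af.
  elim=> {g} [g Ag|g_ g L cg_ IH g_L g_g]; first exact/bounded_closure_base/Aop.
  have [M opM] := op_bounded K L.
  apply: (bounded_closure_lim (K := M) IH) => [n x|x]; first exact: opM.
  by apply: op_cvg; [exact: cvg_cst|exact: g_g].
have [L gL] := bounded_closure_bounded cg.
have [M opM] := op_bounded K L.
apply: (bounded_closure_lim (K := M) (fun n => IH n _ cg)) => [n x|x]; first exact: opM.
by apply: op_cvg; [exact: f_f|exact: cvg_cst].
Qed.

Lemma bounded_closure_linear (k : R) f g : bounded_closure f -> bounded_closure g ->
  bounded_closure (fun x => k * f x + g x).
Proof.
apply: (@bounded_closure_op (fun a b => k * a + b)) => [?? | K L | a b a_ b_ ca cb].
- exact: A_lin.
- exists (`|k| * K + L) => a b aK bL.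
  by rewrite (le_trans (ler_normD _ _))// normrM lerD// ler_wpM2l.
- by apply: cvgD => //; apply: cvgMr.
Qed.

Lemma bounded_closure_mul f g : bounded_closure f -> bounded_closure g ->
  bounded_closure (fun x => f x * g x).
Proof.
apply: (@bounded_closure_op (fun a b => a * b)) => [?? | K L | a b a_ b_ ca cb].
- exact: A_mul.
- by exists (K * L) => a b aK bL; rewrite normrM ler_pM.
- exact: cvgM.
Qed.

Hypothesis A_cst1 : A (fun=> 1).

Lemma bounded_closure_scale (k : R) f : bounded_closure f ->
  bounded_closure (fun x => k * f x).
Proof.
move=> cf; have := bounded_closure_linear (k - 1) cf cf.
by congr bounded_closure; apply/funext => x; ring.
Qed.

Lemma bounded_closure_cst (k : R) : bounded_closure (fun=> k).
Proof.
have := bounded_closure_scale k (bounded_closure_base A_cst1).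
by congr bounded_closure; apply/funext => x; ring.
Qed.

(** Once [f] is scaled into [[-1, 1]], the iterates of [smoothstep] are polynomials in [f], hence in
    the class, and they tend boundedly to the sign. *)
Lemma bounded_closure_sg f : bounded_closure f -> bounded_closure (fun x => Num.sg (f x)).
Proof.
move=> cf; have [K fK] := bounded_closure_bounded cf.
pose L := `|K| + 1; have L0 : 0 < L by rewrite ltr_wpDl.
have fL x : `|L^-1 * f x| <= 1.
  rewrite normrM gtr0_norm ?invr_gt0// mulrC ler_pdivrMr// mul1r.
  by rewrite (le_trans (fK x))// /L; have := ler_norm K; lra.
have -> : (fun x => Num.sg (f x)) = fun x => Num.sg (L^-1 * f x).
  by apply/funext => x; rewrite sgrM (@gtr0_sg _ L^-1) ?invr_gt0// mul1r.
apply: (@bounded_closure_lim (fun n x => iter n smoothstep (L^-1 * f x)) _ 1).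
- elim=> [|n IH]; first exact: bounded_closure_scale.
  have /(bounded_closure_scale (- 2^-1)) := bounded_closure_mul IH (bounded_closure_mul IH IH).
  move/(bounded_closure_linear (3 / 2) IH).
  by congr bounded_closure; apply/funext => x; rewrite iterS /smoothstep; field.
- by move=> n x; exact: smoothstep_bound.
- by move=> x; exact: smoothstep_cvg.
Qed.

(** With [s] the sign, [(s + s^2) / 2] is 1 at positive numbers and 0 elsewhere. *)
Lemma bounded_closure_gt0 f : bounded_closure f ->
  bounded_closure (\1_[set x | 0 < f x]).
Proof.
move=> /bounded_closure_sg cf.
have := bounded_closure_scale 2^-1 (bounded_closure_linear 1 cf (bounded_closure_mul cf cf)).
congr bounded_closure; apply/funext => x; rewrite indicE.
have [x0|x0|x0] := ltgtP 0 (f x).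
- by rewrite mem_set//= gtr0_sg//; field.
- by rewrite memNset/= ?(ltr0_sg x0) ?(lt_gtF x0)//; field.
- by rewrite memNset/= -?x0 ?ltxx// sgr0; ring.
Qed.

(** Complements come from [1 - f] and intersections from products; a countable union is a bounded
    pointwise limit of finite unions. *)
Lemma bounded_closure_sigma_algebra :
  sigma_algebra setT [set B | bounded_closure (\1_B)].
Proof.
have cC B : bounded_closure (\1_B) -> bounded_closure (\1_(~` B)).
  move=> cB; have := bounded_closure_linear (-1) cB (bounded_closure_cst 1).
  by congr bounded_closure; apply/funext => x; rewrite !indicE in_setC; case: (x \in B) => /=; ring.
have cU B C : bounded_closure (\1_B) -> bounded_closure (\1_C) ->
    bounded_closure (\1_(B `|` C)).
  move=> /cC cB /cC cC'; rewrite -[_ `|` _]setCK setCU; apply: cC.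
  by have := bounded_closure_mul cB cC'; rewrite indicI.
split=> [/=|B /= |B cB /=].
- by rewrite indic0; exact: bounded_closure_cst.
- by rewrite setTD; exact: cC.
- apply: (@bounded_closure_lim (fun n => \1_(\big[setU/set0]_(k < n) B k)) _ 1).
  + elim=> [|n IH]; first by rewrite big_ord0 indic0; exact: bounded_closure_cst.
    by rewrite big_ord_recr; exact: cU IH (cB n).
  + by move=> n x; rewrite indicE; case: (_ \in _); rewrite ?normr1 ?normr0 ?ler01.
  + move=> x; apply: cvg_near_cst; rewrite !indicE.
    have [[k _ Bkx]|nB] := pselect ((\bigcup_k B k) x).
      near=> n; rewrite indicE !mem_set//; first by exists k.
      rewrite -bigcup_mkord; exists k => //=; near: n; exact: nbhs_infty_gt.
    apply: nearW => n; rewrite indicE !memNset//.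
    by rewrite -bigcup_mkord => -[k _ Bkx]; apply: nB; exists k.
Unshelve. all: by end_near.
Qed.

End bounded_closure.

Lemma bounded_closure_measurable {R : realType} d (T : measurableType d)
    (A : set (T -> R)) :
  (forall f, A f -> measurable_fun setT f) ->
  forall f, bounded_closure A f -> measurable_fun setT f.
Proof.
move=> mA f; elim=> [g /mA//|f_ g K _ mf_ _ f_g].
by apply: (measurable_fun_cvg mf_) => x _; exact: f_g.
Qed.

Lemma bounded_closure_expectation {R : realType} d d' (Omega : measurableType d)
    (P : probability Omega R) (T : measurableType d') (A : set (T -> R))
    (X Y : Omega -> T) :
  measurable_fun setT X -> measurable_fun setT Y ->
  (forall f, A f -> measurable_fun setT f) ->
  (forall f, A f -> (\int[P]_w f (X w) = \int[P]_w f (Y w))%R) ->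
  forall f, bounded_closure A f -> (\int[P]_w f (X w) = \int[P]_w f (Y w))%R.
Proof.
move=> mX mY mA eqA f; elim=> [g /eqA//|f_ g K cf_ IH f_K f_g].
have mf_ n := bounded_closure_measurable mA (cf_ n).
have cX := @bounded_cvg_Rintegral _ _ _ P (fun n => f_ n \o X) (g \o X) K
  (fun n => measurableT_comp (mf_ n) mX) (fun n w => f_K n (X w)) (fun w => f_g (X w)).
have cY := @bounded_cvg_Rintegral _ _ _ P (fun n => f_ n \o Y) (g \o Y) K
  (fun n => measurableT_comp (mf_ n) mY) (fun n w => f_K n (Y w)) (fun w => f_g (Y w)).
have e : (fun n => \int[P]_w (f_ n \o X) w)%R = (fun n => \int[P]_w (f_ n \o Y) w)%R.
  by apply/funext => n; exact: IH.
by rewrite e in cX; exact: cvg_unique cX cY.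
Qed.

(** * Trigonometric polynomials on R^n *)

Section characteristic_function.
Context {R : realType} (n : nat).
Local Notation T := (n.-tuple R).

Definition linear_form (theta : 'I_n -> R) (x : T) : R := \sum_(i < n) theta i * tnth x i.

(** The free phase [c] makes sines instances of the first constructor and keeps the family stable
    under products, by the product-to-sum formula. *)
Inductive trig_poly : (T -> R) -> Prop :=
| trig_poly_cos a theta c : trig_poly (fun x => a * cos (linear_form theta x + c))
| trig_poly_add f g : trig_poly f -> trig_poly g -> trig_poly (fun x => f x + g x).

Lemma linear_formD theta eta x :
  linear_form (fun i => theta i + eta i) x = linear_form theta x + linear_form eta x.
Proof. by rewrite -big_split; apply: eq_bigr => i _; rewrite mulrDl. Qed.

Lemma linear_formN theta x :
  linear_form (fun i => - theta i) x = - linear_form theta x.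
Proof. by rewrite -sumrN; apply: eq_bigr => i _; rewrite mulNr. Qed.

Lemma linear_form_measurable theta : measurable_fun setT (linear_form theta).
Proof.
apply: measurable_sum => i; apply: measurable_funM => //; exact: measurable_tnth.
Qed.

Lemma trig_poly_bounded f : trig_poly f -> exists K : R, forall x, `|f x| <= K.
Proof.
elim=> [a theta c|{}f g _ [K fK] _ [L gL]].
  by exists `|a| => x; rewrite normrM ler_piMr// cos_max.
by exists (K + L) => x; rewrite (le_trans (ler_normD _ _))// lerD.
Qed.

Lemma trig_poly_measurable f : trig_poly f -> measurable_fun setT f.
Proof.
elim=> [a theta c|{}f g _ mf _ mg]; last exact: measurable_funD.
apply: measurable_funM => //; apply: measurableT_comp => //.
  by apply: continuous_measurable_fun; exact: continuous_cos.
by apply: measurable_funD => //; exact: linear_form_measurable.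
Qed.

Lemma trig_poly_linear (k : R) f g : trig_poly f -> trig_poly g ->
  trig_poly (fun x => k * f x + g x).
Proof.
move=> tf tg; apply: trig_poly_add => //.
elim: tf => [a theta c|{}f f' _ tf _ tf'].
  by have := trig_poly_cos (k * a) theta c; congr trig_poly; apply/funext => x; ring.
by have := trig_poly_add tf tf'; congr trig_poly; apply/funext => x; ring.
Qed.

Lemma trig_poly_mul f g : trig_poly f -> trig_poly g ->
  trig_poly (fun x => f x * g x).
Proof.
move=> + tg; elim=> [a theta c|{}f f' _ tf _ tf']; last first.
  by have := trig_poly_add tf tf'; congr trig_poly; apply/funext => x; ring.
elim: tg => [b eta e|{}g g' _ tg _ tg']; last first.
  by have := trig_poly_add tg tg'; congr trig_poly; apply/funext => x; ring.
have := trig_poly_add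
  (trig_poly_cos (a * b / 2) (fun i => theta i + eta i) (c + e))
  (trig_poly_cos (a * b / 2) (fun i => theta i + - eta i) (c - e)).
congr trig_poly; apply/funext => x; rewrite !linear_formD linear_formN.
have -> : linear_form theta x - linear_form eta x + (c - e) =
  (linear_form theta x + c) - (linear_form eta x + e) by ring.
rewrite addrACA; move: (linear_form theta x + c) (linear_form eta x + e) => u v.
by rewrite (cosB u v) (cosD u v); field.
Qed.

Lemma trig_poly_cst1 : trig_poly (fun=> 1).
Proof.
have := trig_poly_cos 1 (fun=> 0) 0; congr trig_poly; apply/funext => x.
by rewrite /linear_form big1 ?addr0 ?cos0 ?mulr1// => i _; rewrite mul0r.
Qed.

Let closure := bounded_closure trig_poly.

(** For large [k] both [|x_i - m| / (k + 1)] and [rho / (k + 1)] lie in [[0, pi]], where the cosine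
    decreases, so the condition becomes a comparison of cosines. For fixed [k] periodicity spoils
    this far from [m]; hence the limit in [k]. *)
Let closure_itv (i : 'I_n) (m rho : R) : 0 < rho ->
  closure (\1_[set x : T | `|tnth x i - m| < rho]).
Proof.
move=> rho0.
pose B k := [set x : T | 0 < cos (k.+1%:R^-1 * (tnth x i - m)) - cos (k.+1%:R^-1 * rho)].
apply: (@bounded_closure_lim _ _ _ (fun k => \1_(B k)) _ 1).
- move=> k; apply: (bounded_closure_gt0 trig_poly_bounded trig_poly_linear trig_poly_mul).
  have h := bounded_closure_base (trig_poly_cos 1 (fun j => k.+1%:R^-1 *+ (j == i)) (- k.+1%:R^-1 * m)).
  have := bounded_closure_linear trig_poly_bounded trig_poly_linear 1 h
    (bounded_closure_cst trig_poly_bounded trig_poly_linear trig_poly_cst1 (- cos (k.+1%:R^-1 * rho))).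
  congr bounded_closure; apply/funext => x; rewrite !mul1r; congr (cos _ - _).
  rewrite /linear_form (bigD1 i)//= eqxx big1 => [|j /negbTE ->]; last by rewrite mul0r.
  by rewrite mulr1n; ring.
- by move=> k x; rewrite indicE; case: (_ \in _); rewrite ?normr1 ?normr0 ?ler01.
- move=> x; apply: cvg_near_cst.
  near=> k; congr (_ %:R); rewrite /B.
  have k0 : 0 < k.+1%:R^-1 :> R by rewrite invr_gt0.
  have small y : y <= k.+1%:R -> k.+1%:R^-1 * y <= pi :> R.
    move=> yk; rewrite mulrC ler_pdivrMr//; rewrite (le_trans yk)// ler_peMl//.
    by rewrite (le_trans _ (@pi_ge2 R))// ler1n.
  have e : (0 < cos (k.+1%:R^-1 * (tnth x i - m)) - cos (k.+1%:R^-1 * rho)) =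
      (`|tnth x i - m| < rho).
    rewrite subr_gt0 -(cos_norm (_ * (tnth x i - m))) normrM (gtr0_norm k0) ltr_cos ?ltr_pM2l//.
      by rewrite in_itv/= mulr_ge0 ?(ltW k0) ?(ltW rho0)// small//; apply: ltW; near: k; exact: near_natS_gt.
    by rewrite in_itv/= mulr_ge0 ?(ltW k0) ?(ltW rho0)// small//; apply: ltW; near: k; exact: near_natS_gt.
  by congr nat_of_bool; apply/idP/idP; rewrite !inE/= e.
Unshelve. all: by end_near.
Qed.

(** The sets of reals whose preimage under a coordinate has its indicator in the closure form a
    sigma-algebra, so half-lines []a, +oo[] suffice. These are limits of the intervals with centre
    [a + k + 1] and radius [k + 1]. *)
Lemma trig_poly_closure_indic (B : set T) : measurable B -> closure (\1_B).
Proof.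
have sig := bounded_closure_sigma_algebra trig_poly_bounded trig_poly_linear
  trig_poly_mul trig_poly_cst1.
suff gen i (C : set R) : measurable C -> closure (\1_(@tnth n R ^~ i @^-1` C)).
  apply: (smallest_sub sig) => B'.
  rewrite -bigcup_seq => -[i _ [C mC <-]]; rewrite setTI; exact: gen.
have sigi : sigma_algebra setT [set C : set R | closure (\1_(@tnth n R ^~ i @^-1` C))].
  have [s0 sC sU] := sig; split => [|C' cC|C' cC] /=.
  - by rewrite preimage_set0.
  - by rewrite setTD preimage_setC -setTD; exact: sC.
  - by rewrite preimage_bigcup; exact: sU.
move=> mC; have : (RGenOInfty.G (R := R)).-sigma.-measurable C.
  by rewrite -RGenOInfty.measurableE.
move: {mC} C; apply: (smallest_sub sigi) => _ [a ->] /=.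
apply: (@bounded_closure_lim _ _ _ (fun k => \1_[set x : T | `|tnth x i - (a + k.+1%:R)| < k.+1%:R]) _ 1).
- by move=> k; exact: closure_itv.
- by move=> k x; rewrite indicE; case: (_ \in _); rewrite ?normr1 ?normr0 ?ler01.
- move=> x; apply: cvg_near_cst; near=> k; congr (_ %:R); congr nat_of_bool.
  apply/idP/idP; rewrite !inE/= in_itv/= andbT ltr_distl; first by move=> /andP[]; lra.
  move=> ax; apply/andP; split; first lra.
  suff : tnth x i - a < k.+1%:R by lra.
  by near: k; exact: near_natS_gt.
Unshelve. all: by end_near.
Qed.

End characteristic_function.

(** The addition formula removes the phase [c], so the two hypotheses give equal expectations of all
    trigonometric polynomials; the closure carries the equality to [\1_B]. *)
Lemma charfun_unique {R : realType} d (Omega : measurableType d)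
    (P : probability Omega R) n (X Y : Omega -> n.-tuple R) :
  measurable_fun setT X -> measurable_fun setT Y ->
  (forall theta, (\int[P]_w cos (linear_form theta (X w)) =
                  \int[P]_w cos (linear_form theta (Y w)))%R) ->
  (forall theta, (\int[P]_w sin (linear_form theta (X w)) =
                  \int[P]_w sin (linear_form theta (Y w)))%R) ->
  forall B, measurable B -> P (X @^-1` B) = P (Y @^-1` B).
Proof.
move=> mX mY ecos esin B mB.
have mindic (Z : Omega -> n.-tuple R) : measurable_fun setT Z -> measurable (Z @^-1` B).
  by move=> mZ; rewrite -[_ @^-1` _]setTI; exact: mZ.
have fE (Z : Omega -> n.-tuple R) : measurable_fun setT Z ->
    P (Z @^-1` B) = ((\int[P]_w \1_B (Z w))%R)%:E.
  move=> mZ; have e : (\int[P]_w (\1_B (Z w))%:E)%E = P (Z @^-1` B).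
    by rewrite -[LHS]/(\int[P]_w (\1_(Z @^-1` B) w)%:E)%E integral_indic ?setIT//; exact: mindic.
  by rewrite /Rintegral e fineK//; exact: fin_num_measure (mindic _ mZ).
rewrite !fE//; congr EFin.
apply: (bounded_closure_expectation mX mY _ _ (trig_poly_closure_indic mB)).
  exact: trig_poly_measurable.
move=> f tf.
have bint (f' : n.-tuple R -> R) (Z : Omega -> n.-tuple R) : measurable_fun setT Z -> trig_poly f' ->
    P.-integrable setT (EFin \o (f' \o Z : Omega -> R)).
  move=> mZ tf'; have [K fK] := trig_poly_bounded tf'.
  apply: (@bounded_integrable _ _ _ _ _ K) => [|w]; last exact: fK.
  by apply: measurableT_comp => //; exact: trig_poly_measurable.
elim: tf => [a theta c|{}f g tf IHf tg IHg]; last first.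
  rewrite (RintegralD measurableT (bint f X mX tf) (bint g X mX tg)).
  by rewrite (RintegralD measurableT (bint f Y mY tf) (bint g Y mY tg)) IHf IHg.
have intc Z : measurable_fun setT Z -> P.-integrable setT (EFin \o (fun w : Omega => cos (linear_form theta (Z w)))).
  move=> mZ; apply: (@bounded_integrable _ _ _ _ _ 1) => [|w]; last exact: cos_max.
  apply: measurableT_comp; first by apply: continuous_measurable_fun; exact: continuous_cos.
  by apply: measurableT_comp => //; exact: linear_form_measurable.
have ints Z : measurable_fun setT Z -> P.-integrable setT (EFin \o (fun w : Omega => sin (linear_form theta (Z w)))).
  move=> mZ; apply: (@bounded_integrable _ _ _ _ _ 1) => [|w]; last exact: sin_max.
  apply: measurableT_comp; first by apply: continuous_measurable_fun; exact: continuous_sin.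
  by apply: measurableT_comp => //; exact: linear_form_measurable.
have E Z : measurable_fun setT Z ->
  (\int[P]_w (a * cos (linear_form theta (Z w) + c)) =
   (a * cos c) * \int[P]_w cos (linear_form theta (Z w)) +
   (- (a * sin c)) * \int[P]_w sin (linear_form theta (Z w)))%R.
  move=> mZ; rewrite -RintegralZl//; last exact: intc.
  rewrite -RintegralZl//; last exact: ints.
  rewrite -RintegralD//; last 2 first.
    exact: (integrableZl measurableT (a * cos c) (intc Z mZ)).
    exact: (integrableZl measurableT (- (a * sin c)) (ints Z mZ)).
  by apply: eq_Rintegral => w _; rewrite cosD; ring.
by rewrite !E// ecos esin.
Qed.

(** * Stable variables and convergence in probability *)

Section trigonometry.
Context {R : realType}.
Implicit Types x y a : R.

Lemma measurable_cos : measurable_fun setT (@cos R).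
Proof. by apply: continuous_measurable_fun; exact: continuous_cos. Qed.

Lemma measurable_sin : measurable_fun setT (@sin R).
Proof. by apply: continuous_measurable_fun; exact: continuous_sin. Qed.

Lemma lipschitz1_of_derive (f df : R -> R) :
  (forall x, is_derive x 1 f (df x)) -> (forall x, `|df x| <= 1) ->
  forall x y, `|f x - f y| <= `|x - y|.
Proof.
move=> fdf df1.
have H x y : x <= y -> `|f x - f y| <= `|x - y|.
  move=> xy; have cf : {within `[x, y], continuous f}.
    apply: continuous_subspaceT => z; apply: differentiable_continuous.
    by apply/derivable1_diffP; apply: ex_derive.
  have [c _ e] := MVT_segment xy (fun z _ => fdf z) cf.
  by rewrite distrC e normrM (distrC x) ler_piMl.
move=> x y; have [/H//|/ltW/H] := leP x y.
by rewrite distrC (distrC x).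
Qed.

Lemma lipschitz1_cos x y : `|cos x - cos y| <= `|x - y|.
Proof.
apply: (@lipschitz1_of_derive cos (fun x => - sin x)) => z.
by rewrite normrN sin_max.
Qed.

Lemma lipschitz1_sin x y : `|sin x - sin y| <= `|x - y|.
Proof. by apply: (@lipschitz1_of_derive sin cos) => z; exact: cos_max. Qed.

Lemma integral_1Bcos a y : 0 < a -> y != 0 ->
  (\int[lebesgue_measure]_(t in `[0%R, a]) (1 - cos (t * y))%:E =
   (a - sin (a * y) / y)%:E)%E.
Proof.
move=> a0 y0.
pose F t : R := t - y^-1 * sin (t * y).
have dF (t : R) : is_derive t 1 F (1 - cos (t * y)).
  have d1 : is_derive t 1 (fun t : R => t * y) y.
    by apply: is_derive_eq; rewrite /GRing.scale/= mulr1 mulr0 add0r.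
  have d2 : is_derive t 1 (fun t : R => sin (t * y)) (y * cos (t * y)).
    have d2 := @is_derive1_comp _ sin (fun t : R => t * y) t _ _ (is_derive_sin (t * y)) d1.
    by rewrite mulrC; exact: d2.
  rewrite [X in is_derive _ _ _ X](_ : _ = 1 - y^-1 *: (y * cos (t * y))); last first.
    by rewrite /GRing.scale/= mulrA mulVf// mul1r.
  exact: is_deriveB.
have cF : continuous F.
  move=> t; apply: differentiable_continuous.
  by apply/derivable1_diffP; apply: ex_derive.
rewrite (@continuous_FTC2 _ _ F)//.
- by rewrite -EFinB /F mul0r sin0 mulr0 subr0 subr0 (mulrC y^-1).
- have ccos : continuous (fun t : R => cos (t * y)).
    by move=> t; apply: continuous_comp; [exact: mulrr_continuous|exact: continuous_cos].
  by apply: continuous_subspaceT => t; apply: cvgB; [exact: cvg_cst|exact: ccos].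
- split.
  + by move=> t _; apply: ex_derive.
  + by apply: cvg_at_right_filter; exact: cF.
  + by apply: cvg_at_left_filter; exact: cF.
- by move=> t _; rewrite derive1E; apply: derive_val.
Qed.

End trigonometry.

Section convergence_in_probability.
Context {R : realType} d (Omega : measurableType d) (P : probability Omega R).
Implicit Types (X Y : Omega -> R).

Lemma measurable_norm_ge X (eps : R) : measurable_fun setT X ->
  measurable [set w | eps <= `|X w|].
Proof.
move=> mX; rewrite -[X in measurable X]setTI.
have -> : [set w | eps <= `|X w|] = (Num.norm \o X) @^-1` `[eps, +oo[.
  by apply/seteqP; split=> w /=; rewrite in_itv/= andbT.
by apply: measurableT_comp => //; exact: measurable_normr.
Qed.

Lemma cvg_in_probability_ae (X_ Y_ : nat -> Omega -> R) X Y :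
  (forall n, measurable_fun setT (X_ n)) -> (forall n, measurable_fun setT (Y_ n)) ->
  measurable_fun setT X -> measurable_fun setT Y ->
  (forall n, {ae P, forall w, X_ n w = Y_ n w}) -> {ae P, forall w, X w = Y w} ->
  cvg_in_probability P X_ X -> cvg_in_probability P Y_ Y.
Proof.
move=> mX_ mY_ mX mY XY_ XY cX eps eps0; have := cX _ eps0.
rewrite (_ : (fun n => P [set w | eps <= `|X_ n w - X w|]) =
             (fun n => P [set w | eps <= `|Y_ n w - Y w|]))//; apply/funext => n.
have m1 := @measurable_norm_ge (X_ n \- X) eps (measurable_funB (mX_ n) mX).
have m2 := @measurable_norm_ge (Y_ n \- Y) eps (measurable_funB (mY_ n) mY).
have E (Z : Omega -> R) : measurable [set w | eps <= `|Z w|] ->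
    P [set w | eps <= `|Z w|] = (\int[P]_w (\1_[set w | eps <= `|Z w|] w)%:E)%E.
  by move=> mZ; rewrite integral_indic ?setIT.
rewrite (E (X_ n \- X) m1) (E (Y_ n \- Y) m2).
apply: ae_eq_integral => //.
- by apply/measurable_EFinP; exact: measurable_indic.
- by apply/measurable_EFinP; exact: measurable_indic.
- have [N1 [mN1 N10 sN1]] := XY_ n; have [N2 [mN2 N20 sN2]] := XY.
  exists (N1 `|` N2); split; [exact: measurableU|exact: null_set_setU|].
  move=> w /= h; apply: contrapT => /not_orP[n1 n2]; apply: h => _.
  have e1 : X_ n w = Y_ n w by apply: contrapT => ?; apply: n1; exact: sN1.
  have e2 : X w = Y w by apply: contrapT => ?; apply: n2; exact: sN2.
  by rewrite !indicE; congr (_ %:R%:E); congr nat_of_bool; apply/idP/idP; rewrite !inE/= e1 e2.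
Qed.

Lemma cvg_in_probability_lin (k : R) (X_ Y_ : nat -> Omega -> R) X Y :
  (forall n, measurable_fun setT (X_ n)) -> (forall n, measurable_fun setT (Y_ n)) ->
  measurable_fun setT X -> measurable_fun setT Y ->
  cvg_in_probability P X_ X -> cvg_in_probability P Y_ Y ->
  cvg_in_probability P (fun n w => k * X_ n w + Y_ n w) (fun w => k * X w + Y w).
Proof.
move=> mX_ mY_ mX mY cX cY eps eps0.
have e2 : 0 < eps / 2 by rewrite divr_gt0.
(* Dividing by [|k| + 1] instead of [|k|] covers [k = 0]. *)
have e1 : 0 < eps / 2 / (`|k| + 1) by rewrite divr_gt0// ltr_wpDl.
have := cvgeD _ (cX _ e1) (cY _ e2); rewrite adde0 => /(_ _ isT) cXY.
apply: (squeeze_cvge _ (cvg_cst 0%E) cXY); apply: nearW => n; rewrite measure_ge0/=.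
have m1 := @measurable_norm_ge (X_ n \- X) (eps / 2 / (`|k| + 1)) (measurable_funB (mX_ n) mX).
have m2 := @measurable_norm_ge (Y_ n \- Y) (eps / 2) (measurable_funB (mY_ n) mY).
apply: le_trans (measureU2 P m1 m2); apply: le_measure; rewrite ?inE//.
- apply: (@measurable_norm_ge (fun w => k * X_ n w + Y_ n w - (k * X w + Y w))).
  by apply: measurable_funB; apply: measurable_funD => //; apply: measurable_funM.
- exact: measurableU.
- move=> w /= h; apply: contrapT => /not_orP[/negP + /negP]; rewrite -!ltNge => h1 h2.
  have hk : `|k| * `|X_ n w - X w| <= eps / 2.
    rewrite ltr_pdivlMr ?ltr_wpDl// in h1.
    by apply: le_trans (ltW h1); rewrite mulrC ler_wpM2l// lerDl.
  have : `|k * X_ n w + Y_ n w - (k * X w + Y w)| <= `|k| * `|X_ n w - X w| + `|Y_ n w - Y w|.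
    rewrite -normrM; apply: le_trans (ler_normD _ _).
    by rewrite (_ : _ - _ = k * (X_ n w - X w) + (Y_ n w - Y w))//; ring.
  by move: h h2; lra.
Qed.

(** Where [|X_n - X| < eps] the Lipschitz bound keeps the difference of the values of [h] below
    [e / 3]. Elsewhere it is at most 2, on an event of probability below [e / 6]. The total is below
    [2 e / 3]. *)
Lemma cvg_in_probability_expectation (h : R -> R) (X_ : nat -> Omega -> R) X (L : R) :
  measurable_fun setT h -> (forall x, `|h x| <= 1) ->
  (forall x y, `|h x - h y| <= L * `|x - y|) ->
  (forall n, measurable_fun setT (X_ n)) -> measurable_fun setT X ->
  cvg_in_probability P X_ X ->
  (\int[P]_w h (X_ n w))%R @[n --> \oo] --> (\int[P]_w h (X w))%R.
Proof.
move=> mh h1 hL mX_ mX cX.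
have L0 : 0 <= L by have := hL 1 0; rewrite subr0 normr1 mulr1; exact: le_trans.
have ih (Z : Omega -> R) : measurable_fun setT Z -> P.-integrable setT (EFin \o (h \o Z)).
  by move=> mZ; apply: (@bounded_integrable _ _ _ _ _ 1) => [|w]; [exact: measurableT_comp|exact: h1].
apply/cvgrPdist_lt => e e0.
pose eps := e / 3 / (L + 1).
have L1 : 0 < L + 1 by rewrite ltr_wpDl.
have eps0 : 0 < eps by rewrite !divr_gt0.
have /fine_cvg/cvgrPdist_lt/(_ (e / 6)) := cX _ eps0.
rewrite divr_gt0// => /(_ isT); apply: filterS => n.
rewrite sub0r normrN => hn.
have mA := @measurable_norm_ge (X_ n \- X) eps (measurable_funB (mX_ n) mX).
set A := [set w | _] in hn mA.
rewrite -RintegralB//; [|exact: (ih X)|exact: (ih (X_ n))].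
have iD : P.-integrable setT (EFin \o (fun w => h (X w) - h (X_ n w))).
  exact: (integrableB measurableT (ih X mX) (ih (X_ n) (mX_ n))).
apply: le_lt_trans (le_normr_Rintegral measurableT iD) _.
have iA : P.-integrable setT (EFin \o (fun w => e / 3 + 2 * \1_A w)).
  apply: (@bounded_integrable _ _ _ _ _ (e / 3 + 2)).
    by apply: measurable_funD => //; apply: measurable_funM => //; exact: measurable_indic.
  move=> w; rewrite ger0_norm.
    by rewrite lerD2l indicE ler_piMr//; case: (_ \in _).
  by rewrite addr_ge0 ?mulr_ge0 ?divr_ge0 ?(ltW e0)// indicE.
apply: (@le_lt_trans _ _ (\int[P]_w (e / 3 + 2 * \1_A w))).
  apply: le_Rintegral => //; first exact: integrable_norm.
  move=> w _; rewrite indicE; case: (boolP (w \in A)) => wA /=.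
    rewrite mulr1 (le_trans (ler_normB _ _))//.
    by have := h1 (X w); have := h1 (X_ n w); lra.
  rewrite mulr0 addr0; move: wA; rewrite notin_setE /A/= => /negP; rewrite -ltNge => wA.
  rewrite (le_trans (hL _ _))// distrC.
  rewrite (@le_trans _ _ ((L + 1) * eps))//.
    by apply: ler_pM => //; [rewrite lerDl|exact: ltW].
  by rewrite /eps mulrC divfK// gt_eqF.
have i1 : P.-integrable setT (EFin \o (\1_A : Omega -> R)).
  apply: (@bounded_integrable _ _ _ _ _ 1); first exact: measurable_indic.
  by move=> w; rewrite indicE; case: (_ \in _); rewrite ?normr1 ?normr0.
have i2 : P.-integrable setT (EFin \o (fun w => 2 * \1_A w)) by exact: (integrableZl measurableT 2 i1).
have i3 : P.-integrable setT (EFin \o (fun _ : Omega => e / 3)).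
  by apply: (@bounded_integrable _ _ _ _ _ `|e / 3|).
rewrite (RintegralD measurableT i3 i2) (RintegralZl _ measurableT i1).
have -> : (\int[P]__ (e / 3) = e / 3)%R.
  transitivity (e / 3 * fine (P setT)); first by rewrite Rintegral_cst.
  by rewrite probability_setT mulr1.
rewrite [X in 2 * X](_ : _ = fine (P A)); last by rewrite /Rintegral integral_indic ?setIT.
have hA : fine (P A) < e / 6 by move: hn; rewrite ger0_norm ?fine_ge0.
by move: hA; move: (fine (P A)) => p; lra.
Qed.

(* Borel-Cantelli: a sequence with summably large increments converges
   uniformly off sets of arbitrarily small probability. *)
Lemma cvg_in_probability_fast_cauchy (X_ : nat -> {RV P >-> R}) :
  (\sum_(n <oo) P [set w | (2^-1 ^+ n <= `|X_ n.+1 w - X_ n w|)%R] < +oo)%E ->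
  exists X : {RV P >-> R}, cvg_in_probability P X_ X.
Proof.
move=> sumF.
pose F n := [set w | 2^-1 ^+ n <= `|X_ n.+1 w - X_ n w|].
have mF n : measurable (F n).
  by apply: (@measurable_norm_ge (X_ n.+1 \- X_ n)); exact: measurable_funB.
have N0 : P (lim_sup_set F) = 0%E by exact: lim_sup_set_cvg0.
have mT n : measurable (\bigcup_(j >= n) F j) by exact: bigcup_measurable.
have mN : measurable (lim_sup_set F) by exact: bigcapT_measurable.
(* Outside the union the increments from [n] to [m - 1] are below [2^-j], and their sum telescopes
   to [2 (2^-n - 2^-m)]. *)
have bnd n m w : (n <= m)%N -> ~ (\bigcup_(j >= n) F j) w ->
    `|X_ m w - X_ n w| <= 2 * (2^-1 ^+ n - 2^-1 ^+ m).
  move=> nm nF; elim: m nm => [|m IH].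
    by rewrite leqn0 => /eqP ->; rewrite !subrr normr0 mulr0.
  rewrite leq_eqVlt => /predU1P[->|nm]; first by rewrite !subrr normr0 mulr0.
  have Fm : `|X_ m.+1 w - X_ m w| < 2^-1 ^+ m.
    by rewrite ltNge; apply/negP => Fm; apply: nF; exists m.
  have := IH nm; have := ler_normD (X_ m.+1 w - X_ m w) (X_ m w - X_ n w).
  by rewrite addrA subrK exprS; lra.
have half_cvg : (2 * 2^-1 ^+ n : R) @[n --> \oo] --> (0 : R).
  rewrite -[X in _ --> X](mulr0 (2 : R)); apply: cvgMr.
  by apply: cvg_expr; rewrite ger0_norm; lra.
have cv w : ~ lim_sup_set F w -> cvgn (X_ ^~ w).
  rewrite /lim_sup_set => /existsNP[N /not_implyP[_ nF]].
  apply: cauchy_cvg; apply: cauchy_exP => e e0.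
  have := half_cvg => /cvgrPdist_lt/(_ _ e0)[M _ HM].
  pose K := maxn N M; exists (X_ K w).
  exists K => // m /= Km; rewrite /ball/= distrC.
  have nFK : ~ (\bigcup_(j >= K) F j) w.
    by move=> [j /= Kj Fj]; apply: nF; exists j => //=; exact: leq_trans (leq_maxl _ _) Kj.
  apply: le_lt_trans (bnd _ _ _ Km nFK) _.
  have := HM K (leq_maxr _ _); rewrite sub0r normrN ger0_norm ?mulr_ge0 ?exprn_ge0//.
  have : 0 <= 2^-1 ^+ m :> R by rewrite exprn_ge0.
  lra.
(* The indicator makes the sequence converge everywhere, to 0 on the exceptional set, so the limit
   is measurable. *)
pose X w := lim ((X_ n w * \1_(~` lim_sup_set F) w) @[n --> \oo]).
have XE w : ~ lim_sup_set F w -> X w = lim (X_ n w @[n --> \oo]).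
  move=> nw; rewrite /X; congr (lim (_ @ \oo)); apply/funext => n.
  by rewrite indicE mem_set ?mulr1.
have mX : measurable_fun setT X.
  apply: (@measurable_fun_cvg _ _ _ _ (fun n w => X_ n w * \1_(~` lim_sup_set F) w)).
    move=> n; apply: measurable_funM => //; apply: measurable_indic; exact: measurableC.
  move=> w _; rewrite /X; have [w0|w0] := pselect (lim_sup_set F w).
    rewrite indicE memNset//=; under eq_fun do rewrite mulr0.
    by apply: cvgP; exact: cvg_cst.
  rewrite indicE mem_set//=; under eq_fun do rewrite mulr1.
  exact: cv.
pose X' : {RV P >-> R} := HB.pack X (isMeasurableFun.Build _ _ _ _ X mX).
exists X' => eps eps0.
have cT : P (\bigcup_(j >= n) F j) @[n --> \oo] --> 0%E.
  have h : P (\bigcup_(j >= n) F j) @[n --> \oo] --> P (lim_sup_set F).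
    by apply: (lim_sup_set_cvg P F mF); rewrite -ge0_fin_numE ?measure_ge0 ?fin_num_measure.
  by rewrite N0 in h.
apply: (squeeze_cvge _ (cvg_cst 0%E) cT).
have := half_cvg => /cvgrPdist_lt/(_ _ eps0); apply: filterS => n.
rewrite sub0r normrN ger0_norm ?mulr_ge0 ?exprn_ge0// => hn; rewrite measure_ge0/=.
apply: le_measure; rewrite ?inE//.
  by apply: (@measurable_norm_ge (X_ n \- X')); exact: measurable_funB.
move=> w /= /negP; apply: contra_notP => nF; apply/negP; rewrite -ltNge.
apply: le_lt_trans hn.
have nw : ~ lim_sup_set F w by move=> /(_ n Logic.I).
rewrite XE// distrC.
have c1 : `|X_ m w - X_ n w| @[m --> \oo] --> `|lim (X_ m w @[m --> \oo]) - X_ n w|.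
  by apply: cvg_norm; apply: cvgB; [exact: cv|exact: cvg_cst].
apply: (cvgr_to_le c1); near=> m.
have nm : (n <= m)%N by near: m; exact: nbhs_infty_ge.
apply: le_trans (bnd _ _ _ nm nF) _.
have : 0 <= 2^-1 ^+ m :> R by rewrite exprn_ge0.
by lra.
Unshelve. all: by end_near.
Qed.

End convergence_in_probability.

(** * Tails and limits of stable variables *)

Section stable_law.
Context {R : realType} d (Omega : measurableType d) (P : probability Omega R).
Variable alpha : R.
Hypothesis alpha_gt0 : 0 < alpha.
Implicit Type Y : {RV P >-> R}.

Lemma SaSP (c : R) Y : SaS alpha c Y <-> forall theta : R,
  (\int[P]_w cos (theta * Y w) = expR (- (`|theta| `^ alpha * c)))%R /\
  (\int[P]_w sin (theta * Y w) = 0)%R.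
Proof.
have m theta : measurable_fun setT (fun w => theta * Y w) by exact: measurable_funM.
have Ec theta : ('E_P[fun w => cos (theta * Y w)%R] = (\int[P]_w cos (theta * Y w))%R%:E)%E.
  apply: (@bounded_expectationE _ _ _ _ _ 1) => [|w]; last exact: cos_max.
  exact: measurableT_comp measurable_cos (m theta).
have Es theta : ('E_P[fun w => sin (theta * Y w)%R] = (\int[P]_w sin (theta * Y w))%R%:E)%E.
  apply: (@bounded_expectationE _ _ _ _ _ 1) => [|w]; last exact: sin_max.
  exact: measurableT_comp measurable_sin (m theta).
split=> h theta; have [] := h theta; rewrite Ec Es.
  by move=> [->] [->].
by move=> -> ->.
Qed.

(* Integrating the characteristic function over [0, 2 / eps]. *)
Lemma SaS_tail (c : R) Y (eps : R) : 0 <= c -> 0 < eps -> SaS alpha c Y ->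
  (P [set w | (eps <= `|Y w|)%R] <= (2 * (2 / eps) `^ alpha * c)%:E)%E.
Proof.
move=> c0 eps0 /SaSP Yc.
pose a := 2 / eps; have a0 : 0 < a by rewrite divr_gt0.
pose mu := @lebesgue_measure R.
pose f (z : Omega * measurableTypeR R) : \bar R :=
  ((1 - cos (z.2 * Y z.1)) * \1_(`[0, a] : set R) z.2)%:E.
have f0 z : (0 <= f z)%E.
  by rewrite lee_fin mulr_ge0 ?subr_ge0 ?cos_le1// indicE.
have mf : measurable_fun setT f.
  apply/measurable_EFinP; apply: measurable_funM.
    apply: measurable_funB => //; apply: measurableT_comp measurable_cos _.
    apply: measurable_funM; first exact: measurable_snd.
    by apply: measurableT_comp => //; exact: measurable_fst.
  have mi : measurable_fun setT (\1_(`[0, a]) : measurableTypeR R -> R).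
    by apply: measurable_indic; exact: measurable_itv.
  exact: (measurableT_comp mi measurable_snd).
have tonelli := @fubini_tonelli _ _ _ _ R P mu f mf f0.
have inner w : (\int[mu]_y f (w, y) = \int[mu]_(y in `[0%R, a]) (1 - cos (y * Y w))%:E)%E.
  rewrite [RHS]integral_mkcond; apply: eq_integral => y _.
  by rewrite /f/= patchE indicE; case: (y \in _); rewrite ?mulr1 ?mulr0.
pose A := [set w | eps <= `|Y w|].
have mA : measurable A by apply: measurable_norm_ge.
(* On [A] one has [sin (a Y) / Y <= 1 / eps] while [a = 2 / eps], so the integral of [1 - cos (y Y)]
   over [[0, a]] is at least [1 / eps]. *)
have lower : ((eps^-1)%:E * P A <= \int[P]_x \int[mu]_y f (x, y))%E.
  have -> : P A = (\int[P]_w (\1_A w)%:E)%E by rewrite integral_indic ?setIT.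
  rewrite -ge0_integralZl//; last 2 first.
  - by apply/measurable_EFinP; exact: measurable_indic.
  - by rewrite lee_fin invr_ge0 ltW.
  apply: ge0_le_integral => //.
  - by move=> w _; rewrite mule_ge0// lee_fin ?invr_ge0 ?(ltW eps0)// indicE.
  - by apply: measurable_funeM; apply/measurable_EFinP; exact: measurable_indic.
  - exact: measurable_fun_fubini_tonelli_F.
  move=> w _; rewrite indicE; case: (boolP (w \in A)) => wA; last first.
    by rewrite mule0; exact: integral_ge0.
  rewrite mule1 inner; move: wA; rewrite inE /A/= => wA.
  have Y0 : Y w != 0 by rewrite -normr_gt0; exact: lt_le_trans wA.
  rewrite integral_1Bcos// lee_fin.
  have : sin (a * Y w) / Y w <= eps^-1.
    apply: le_trans (ler_norm _) _; rewrite normrM normfV.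
    rewrite -[leRHS]mul1r; apply: ler_pM => //; rewrite ?invr_ge0 ?sin_max//.
    by rewrite lef_pV2 ?posrE// normr_gt0.
  have : a = eps^-1 + eps^-1 by rewrite /a mulrDl mul1r.
  by lra.
(* For [y] in [[0, a]] the expectation of [1 - cos (y Y)] is [1 - exp (- y^alpha c)], hence at most
   [a^alpha c]. *)
have upper : (\int[mu]_y \int[P]_x f (x, y) <= (a * (a `^ alpha * c))%:E)%E.
  apply: (@le_trans _ _ (\int[mu]_y ((a `^ alpha * c) * \1_(`[0, a] : set R) y)%:E)%E).
    apply: ge0_le_integral => //.
    - by move=> y _; exact: integral_ge0.
    - exact: measurable_fun_fubini_tonelli_G.
    - by apply/measurable_EFinP; apply: measurable_funM => //; apply: measurable_indic; exact: measurable_itv.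
    move=> y _; rewrite /f/= indicE; case: (boolP (y \in _)) => ya; last first.
      by rewrite mulr0; under eq_integral do rewrite mulr0; rewrite integral0.
    rewrite mulr1; under eq_integral do rewrite mulr1.
    have ic : P.-integrable setT (EFin \o (fun w => cos (y * Y w))).
      apply: (@bounded_integrable _ _ _ _ _ 1) => [|w]; last exact: cos_max.
      by apply: measurableT_comp measurable_cos _; exact: measurable_funM.
    have i1 : P.-integrable setT (EFin \o (fun _ : Omega => 1)).
      exact: (@bounded_integrable _ _ _ _ _ `|1|).
    have -> : (\int[P]_x (1 - cos (y * Y x))%:E = (\int[P]_x (1 - cos (y * Y x)))%R%:E)%E.
      by rewrite /Rintegral fineK//; apply: integrable_fin_num => //; exact: (integrableB measurableT i1 ic).
    rewrite lee_fin RintegralB//.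
    have -> : (\int[P]__ 1 = 1)%R.
      transitivity (1 * fine (P setT)); first by rewrite Rintegral_cst.
      by rewrite probability_setT mulr1.
    have [-> _] := Yc y.
    have := expR_ge1Dx (- (`|y| `^ alpha * c)).
    suff : `|y| `^ alpha * c <= a `^ alpha * c by lra.
    rewrite ler_wpM2r// ge0_ler_powR ?nnegrE ?(ltW alpha_gt0) ?(ltW a0)//.
    by move: ya; rewrite inE/= in_itv/= => /andP[y0 ya]; rewrite ger0_norm.
  under eq_integral do rewrite EFinM.
  rewrite ge0_integralZl//; last 2 first.
  - by apply/measurable_EFinP; apply: measurable_indic; exact: measurable_itv.
  - by rewrite lee_fin mulr_ge0 ?powR_ge0.
  rewrite integral_indic// setIT.
  have e : (lebesgue_measure (`[0%R, a] : set R) = a%:E)%E.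
    by rewrite lebesgue_measure_itv/= lte_fin a0 -EFinB subr0.
  by rewrite [X in (_ * X <= _)%E](_ : _ = a%:E)// -EFinM mulrC.
have := le_trans lower (eq_ind _ (fun x => (x <= _)%E) upper _ (esym tonelli)).
rewrite muleC -lee_pdivlMr ?invr_gt0// invrK -EFinM; congr (_ <= _%:E)%E.
by rewrite /a; field; rewrite gt_eqF.
Qed.

(** The tail bound is 0 at each level [1 / (n + 1)], and these events exhaust [Y != 0]. *)
Lemma SaS_ae_eq_scale0 Y : SaS alpha 0 Y -> {ae P, forall w, Y w = 0}.
Proof.
move=> Y0.
have h n : P [set w | n.+1%:R^-1 <= `|Y w|] = 0%E.
  apply/eqP; rewrite eq_le measure_ge0 andbT.
  have n0 : 0 < n.+1%:R^-1 :> R by rewrite invr_gt0.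
  by have := SaS_tail (lexx 0) n0 Y0; rewrite mulr0.
apply: (@negligibleS _ _ _ P (\bigcup_n [set w | n.+1%:R^-1 <= `|Y w|])).
  move=> w /= /eqP; rewrite -normr_gt0 => Yw.
  have [n _ /(_ n (leqnn n)) hn] := near_natS_gt `|Y w|^-1.
  by exists n => //=; rewrite invf_ple ?posrE// ltW.
apply: negligible_bigcup => n; apply/negligibleP; first exact: measurable_norm_ge.
exact: h.
Qed.

(** [cos (theta x)] and [sin (theta x)] are bounded and [|theta|]-Lipschitz in [x], so their
    expectations pass to the limit in probability. *)
Lemma SaS_cvg (Y_ : nat -> {RV P >-> R}) (c_ : nat -> R) Y (c : R) :
  (forall n, SaS alpha (c_ n) (Y_ n)) -> c_ n @[n --> \oo] --> c ->
  cvg_in_probability P Y_ Y -> SaS alpha c Y.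
Proof.
move=> Yc cc cY; apply/SaSP => theta.
have mth (Z : {RV P >-> R}) : measurable_fun setT (fun w => theta * Z w) by exact: measurable_funM.
have cth := @cvg_in_probability_expectation _ _ _ P.
have mY (Z : {RV P >-> R}) : measurable_fun setT Z by [].
have mt : measurable_fun setT (fun x : R => theta * x) by exact: measurable_funM.
split.
- have c1 := cth (fun x => cos (theta * x)) (fun n => Y_ n) Y `|theta|
    (measurableT_comp measurable_cos mt) (fun x => cos_max _)
    ltac:(by move=> x y; rewrite (le_trans (lipschitz1_cos _ _))// -mulrBr normrM)
    (fun n => mY (Y_ n)) (mY Y) cY.
  apply: (cvg_unique _ c1) => //=.
  have -> : (fun n => \int[P]_w cos (theta * Y_ n w))%R =
      (fun n => expR (- (`|theta| `^ alpha * c_ n))).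
    by apply/funext => n; move/SaSP : (Yc n) => /(_ theta)[].
  have ce : - (`|theta| `^ alpha * c_ n) @[n --> \oo] --> - (`|theta| `^ alpha * c).
    by apply: cvgN; apply: cvgMr.
  exact: (cvg_comp _ _ ce (@continuous_expR R _)).
- have c1 := cth (fun x => sin (theta * x)) (fun n => Y_ n) Y `|theta|
    (measurableT_comp measurable_sin mt) (fun x => sin_max _)
    ltac:(by move=> x y; rewrite (le_trans (lipschitz1_sin _ _))// -mulrBr normrM)
    (fun n => mY (Y_ n)) (mY Y) cY.
  apply: (cvg_unique _ c1) => //=.
  have -> : (fun n => \int[P]_w sin (theta * Y_ n w))%R = (fun=> 0).
    by apply/funext => n; move/SaSP : (Yc n) => /(_ theta)[].
  exact: cvg_cst.
Qed.

Lemma SaS_ae_eq (c : R) (Y Z : {RV P >-> R}) : SaS alpha c Y -> {ae P, forall w, Y w = Z w} -> SaS alpha c Z.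
Proof.
move=> Yc YZ theta; have [<- <-] := Yc theta; rewrite unlock.
have mth (W : {RV P >-> R}) : measurable_fun setT (fun w => theta * W w) by exact: measurable_funM.
split; apply: ae_eq_integral => //.
- by apply/measurable_EFinP; exact: measurableT_comp measurable_cos (mth Z).
- by apply/measurable_EFinP; exact: measurableT_comp measurable_cos (mth Y).
- by apply: filterS YZ => w e _; rewrite /= e.
- by apply/measurable_EFinP; exact: measurableT_comp measurable_sin (mth Z).
- by apply/measurable_EFinP; exact: measurableT_comp measurable_sin (mth Y).
- by apply: filterS YZ => w e _; rewrite /= e.
Qed.

End stable_law.

(** * Characteristic function of a sum of independent variables *)

Section independence.
Context {R : realType} d (Omega : measurableType d) (P : probability Omega R).

(** Indicators give simple functions by linearity. The shift [h + K] is nonnegative, hence a limit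
    of simple functions bounded by [2 K]; subtracting the constant returns [h]. *)
Lemma bounded_measurable_ind (Q : (R -> R) -> Prop) :
  (forall C, measurable C -> Q (\1_C)) ->
  (forall k f g, Q f -> Q g -> Q (fun x => k * f x + g x)) ->
  (forall (f_ : nat -> R -> R) f (K : R),
    (forall n, measurable_fun setT (f_ n)) -> (forall n, Q (f_ n)) ->
    (forall n x, `|f_ n x| <= K) ->
    (forall x, f_ n x @[n --> \oo] --> f x) -> Q f) ->
  forall (h : R -> R) (K : R), measurable_fun setT h -> (forall x, `|h x| <= K) -> Q h.
Proof.
move=> Qind Qlin Qlim h K mh hK.
have Q0 : Q (fun=> 0).
  have : Q (\1_set0) by apply: Qind.
  by rewrite indic0.
have QZ k f : Q f -> Q (fun x => k * f x).
  move=> Qf; have := Qlin k f _ Qf Q0.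
  by congr Q; apply/funext => x; rewrite addr0.
have QD f g : Q f -> Q g -> Q (fun x => f x + g x).
  move=> Qf Qg; have := Qlin 1 f g Qf Qg.
  by congr Q; apply/funext => x; rewrite mul1r.
have Qs (f : {sfun R >-> R}) : Q f.
  have -> : (f : R -> R) = (fun x => \sum_(y <- fset_set (range f)) y * \1_(f @^-1` [set y]) x).
    apply/funext => x; rewrite [LHS]fimfunE fsbig_finite//=.
  elim: (enum_fset _) => [|y s IH].
    by rewrite (_ : (fun x => _) = fun=> 0)//; apply/funext => x; rewrite big_nil.
  rewrite (_ : (fun x => _) = fun x => y * \1_(f @^-1` [set y]) x +
      \sum_(y <- s) y * \1_(f @^-1` [set y]) x); last first.
    by apply/funext => x; rewrite big_cons.
  apply: (QD (fun x => y * \1_(f @^-1` [set y]) x) _ _ IH); apply: QZ; apply: Qind.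
  exact: (@measurable_funPTI _ _ _ _ f [set y] (measurable_set1 y)).
pose h' x : \bar R := (h x + K)%:E.
have h'0 x : (0 <= h' x)%E.
  by rewrite lee_fin; have := hK x; rewrite ler_norml => /andP[]; lra.
have mh' : measurable_fun setT h'.
  by apply/measurable_EFinP; apply: measurable_funD.
have := Qlin (-1) (fun=> K) (fun x => h x + K).
rewrite (_ : (fun x => -1 * K + _) = h); last by apply/funext => x; ring.
apply.
  have : Q (fun x => K * \1_(setT : set R) x) by apply/QZ/Qind.
  by congr Q; apply/funext => x; rewrite indicT mulr1.
have leh n x : nnsfun_approx measurableT mh' n x <= h x + K.
  have := @le_approx _ _ _ setT h' n x (fun x _ => h'0 x) Logic.I.
  by rewrite nnsfun_approxE lee_fin.
apply: (@Qlim (fun n => nnsfun_approx measurableT mh' n) _ (2 * K)) => [n|n|n x|x].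
- by [].
- exact: (Qs (nnsfun_approx measurableT mh' n)).
- rewrite ger0_norm; last exact: fun_ge0.
  by rewrite (le_trans (leh n x))//; have := ler_norm (h x); have := hK x; lra.
- have := @cvg_nnsfun_approx _ _ _ setT measurableT h' mh' (fun x _ => h'0 x) x Logic.I.
  by move/fine_cvgP => [_].
Qed.

(** The case [C = setT] shows that [c] is the mean of [W]. The hypothesis thus says that [W] is
    uncorrelated with the events of [Y], and bounded limits extend this to bounded functions of
    [Y]. *)
Lemma expectation_factor (W Y : Omega -> R) (c K : R) :
  measurable_fun setT W -> measurable_fun setT Y -> (forall w, `|W w| <= K) ->
  (forall C, measurable C ->
    (\int[P]_w (W w * \1_C (Y w)) = c * \int[P]_w \1_C (Y w))%R) ->
  forall (h : R -> R) (L : R), measurable_fun setT h -> (forall x, `|h x| <= L) ->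
    (\int[P]_w (W w * h (Y w)) = c * \int[P]_w h (Y w))%R.
Proof.
move=> mW mY WK Wc h L mh hL.
have K0 : 0 <= K by exact: le_trans (WK point).
pose Q (f : R -> R) := [/\ measurable_fun setT f, exists L, forall x, `|f x| <= L &
  (\int[P]_w (W w * f (Y w)) = c * \int[P]_w f (Y w))%R].
suff [] : Q h by [].
have int1 (f : R -> R) : measurable_fun setT f -> (exists L, forall x, `|f x| <= L) ->
    P.-integrable setT (EFin \o (f \o Y)).
  move=> mf [L' fL]; apply: (@bounded_integrable _ _ _ _ _ L') => [|w]; last exact: fL.
  exact: measurableT_comp.
have int2 (f : R -> R) : measurable_fun setT f -> (exists L, forall x, `|f x| <= L) ->
    P.-integrable setT (EFin \o (fun w => W w * f (Y w))).
  move=> mf [L' fL]; apply: (@bounded_integrable _ _ _ _ _ (K * L')) => [|w].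
    by apply: measurable_funM => //; exact: (measurableT_comp mf mY).
  by rewrite normrM ler_pM.
apply: (@bounded_measurable_ind Q _ _ _ h L) => //.
- move=> C mC; split; [exact: measurable_indic| |exact: Wc].
  by exists 1 => x; rewrite indicE; case: (_ \in _); rewrite ?normr1 ?normr0.
- move=> k f g [mf bf ef] [mg bg eg]; split.
  + by apply: measurable_funD => //; apply: measurable_funM.
  + have [[Lf fL] [Lg gL]] := (bf, bg); exists (`|k| * Lf + Lg) => x.
    by rewrite (le_trans (ler_normD _ _))// normrM lerD// ler_wpM2l.
  + have -> : (\int[P]_w (W w * (k * f (Y w) + g (Y w))) =
               \int[P]_w (k * (W w * f (Y w)) + W w * g (Y w)))%R.
      by apply: eq_Rintegral => w _; ring.
    have i1 := integrableZl measurableT k (int2 _ mf bf).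
    have i2 := integrableZl measurableT k (int1 _ mf bf).
    rewrite (RintegralD measurableT i1 (int2 _ mg bg)).
    rewrite (RintegralD measurableT i2 (int1 _ mg bg)).
    rewrite (RintegralZl _ measurableT (int2 _ mf bf)) (RintegralZl _ measurableT (int1 _ mf bf)).
    rewrite -[X in _ + X = _]/(\int[P]_w (W w * g (Y w)))%R ef eg.
    by rewrite mulrDr mulrCA.
- move=> f_ f L' mf_ Qf_ f_L f_f.
  have mf : measurable_fun setT f by apply: (measurable_fun_cvg mf_) => x _; exact: f_f.
  split => //.
    exists L' => x; apply: (cvgr_to_le (cvg_norm (f_f x))); exact: nearW.
  have c1 := @bounded_cvg_Rintegral _ _ _ P (fun n w => W w * f_ n (Y w)) (fun w => W w * f (Y w)) (K * L')
    (fun n => measurable_funM mW (measurableT_comp (mf_ n) mY))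
    ltac:(by move=> n w; rewrite normrM ler_pM)
    (fun w => cvgMr (f_f (Y w))).
  have c2 := @bounded_cvg_Rintegral _ _ _ P (fun n w => f_ n (Y w)) (fun w => f (Y w)) L'
    (fun n => measurableT_comp (mf_ n) mY) (fun n w => f_L n (Y w)) (fun w => f_f (Y w)).
  have e : (fun n => \int[P]_w (W w * f_ n (Y w)))%R = (fun n => c * \int[P]_w f_ n (Y w))%R.
    by apply/funext => n; have [] := Qf_ n.
  rewrite e in c1; have {}c1 : (c * \int[P]_w f_ n (Y w))%R @[n --> \oo] --> (\int[P]_w (W w * f (Y w)))%R by exact: c1.
  have c3 : (c * \int[P]_w f_ n (Y w))%R @[n --> \oo] --> (c * \int[P]_w f (Y w))%R by exact: cvgMr c2.
  exact: (cvg_unique (@norm_hausdorff _ _) c1 c3).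
Qed.

Lemma Rintegral_indic_comp (Y : Omega -> R) (C : set R) : measurable_fun setT Y ->
  measurable C -> (\int[P]_w \1_C (Y w))%R = fine (P (Y @^-1` C)).
Proof.
move=> mY mC; rewrite /Rintegral; congr fine.
rewrite -[LHS]/(\int[P]_w (\1_(Y @^-1` C) w)%:E)%E integral_indic ?setIT//.
by rewrite -[X in measurable X]setTI; exact: mY.
Qed.

Variable alpha : R.
Hypothesis alpha_gt0 : 0 < alpha.

Section charfun_sum.
Context (n : nat) (Y : 'I_n -> {RV P >-> R}) (a c : 'I_n -> R) (theta : R).
Hypothesis indep : independent_RVs Y.
Hypothesis Yc : forall i, SaS alpha (c i) (Y i).

Let S k w := \sum_(i < n | (i < k)%N) a i * Y i w.
Let e k := expR (- \sum_(i < n | (i < k)%N) `|theta * a i| `^ alpha * c i).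
Let p (B : 'I_n -> set R) := \prod_(i < n) fine (P (Y i @^-1` B i)).
Let G (B : 'I_n -> set R) := \bigcap_i (Y i @^-1` B i).

Let mG B : (forall i, measurable (B i)) -> measurable (G B).
Proof.
move=> mB; rewrite /G.
have -> : \bigcap_i (Y i @^-1` B i) = \big[setI/setT]_(i < n) (Y i @^-1` B i).
  by rewrite -bigcap_seq; apply/seteqP; split => w h i _; apply: h; rewrite //= mem_index_enum.
apply: bigsetI_measurable => i _; rewrite -[X in measurable X]setTI.
exact: measurable_funP.
Qed.

Let mS k : measurable_fun setT (S k).
Proof.
rewrite (_ : S k = fun w => \sum_(i < n) (if (i < k)%N then a i else 0) * Y i w).
  by apply: measurable_sum => i; exact: measurable_funM.
by apply/funext => w; rewrite /S big_mkcond; apply: eq_bigr => i _; case: ifP; rewrite ?mul0r.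
Qed.

(** Independence is a statement on events, so the variables of index at least [k] are carried as
    arbitrary events [B i]. One step frees the event of index [k], which turns the induction
    hypothesis into a factorisation against indicators of [Y_k], then against its cosine and
    sine. *)
Let charfun_sum_rec k : (k <= n)%N -> forall B, (forall i, measurable (B i)) ->
  (forall i : 'I_n, (i < k)%N -> B i = setT) ->
  (\int[P]_w (cos (theta * S k w) * \1_(G B) w) = e k * p B)%R /\
  (\int[P]_w (sin (theta * S k w) * \1_(G B) w) = 0)%R.
Proof.
elim: k => [_ B mB _|k IH kn B mB BT].
  have S0 w : theta * S 0 w = 0 by rewrite /S big_pred0 ?mulr0.
  split; last first.
    rewrite (_ : (fun w => _) = fun=> 0); first by rewrite Rintegral_cst ?mul0r.
    by apply/funext => w; rewrite S0 sin0 mul0r.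
  rewrite /e big_pred0// oppr0 expR0 mul1r.
  rewrite (_ : (fun w => _) = \1_(G B)); last first.
    by apply/funext => w; rewrite S0 cos0 mul1r.
  rewrite /Rintegral integral_indic ?setIT//; last exact: mG.
  rewrite [X in fine X](_ : _ = (\prod_(i < n) P (Y i @^-1` B i))%E); last exact: indep mB.
  rewrite /p (_ : (\prod_(i < n) _)%E = (\prod_(i < n) fine (P (Y i @^-1` B i)))%:E)//.
  rewrite (big_morph EFin EFinM erefl); apply: eq_bigr => i _; rewrite fineK//.
  apply: fin_num_measure; rewrite -[X in measurable X]setTI; exact: measurable_funP.
have k' := kn; pose ik := Ordinal kn.
have {}IH := IH (ltnW kn).
(* [B] is trivial at index [k]; the induction hypothesis for [k] is applied with an arbitrary event
   [C] of [Y_k] in that place. *)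
pose upd (C : set R) i := if i == ik then C else B i.
have mupd C i : measurable C -> measurable (upd C i) by rewrite /upd; case: ifP.
have updT C (i : 'I_n) : (i < k)%N -> upd C i = setT.
  move=> ik0; rewrite /upd; case: eqP => [ei|_]; last by rewrite BT// ltnW.
  by rewrite ei/= ltnn in ik0.
have GE C : G (upd C) = G B `&` (Y ik @^-1` C).
  apply/seteqP; split => [w GC|w [GB YC] i _].
    split=> [i _|]; last by have := GC ik Logic.I; rewrite /upd eqxx.
    have := GC i Logic.I; rewrite /upd; case: eqP => // -> _.
    by rewrite /= BT.
  by rewrite /upd; case: eqP => [->//|_]; exact: GB.
have pE C : p (upd C) = p B * fine (P (Y ik @^-1` C)).
  rewrite /p (bigD1 ik)//= [in RHS](bigD1 ik)//= /upd eqxx.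
  rewrite (BT ik)//= preimage_setT probability_setT mul1r mulrC; congr (_ * _).
  by apply: eq_bigr => i /negbTE ->.
have S1 w : theta * S k.+1 w = theta * S k w + theta * a ik * Y ik w.
  rewrite /S (bigD1 ik)//= mulrDr addrC mulrA; congr (_ * _ + _).
  apply: eq_bigl => i; rewrite ltnS [in RHS]ltn_neqAle andbC; congr (_ && _).
have e1 : e k.+1 = e k * expR (- (`|theta * a ik| `^ alpha * c ik)).
  rewrite /e -expRD -opprD; congr (expR (- _)).
  rewrite (bigD1 ik)//= addrC; congr (_ + _).
  by apply: eq_bigl => i; rewrite ltnS [in RHS]ltn_neqAle andbC.
pose W (f : R -> R) w := f (theta * S k w) * \1_(G B) w.
have fac (f : R -> R) (mf : measurable_fun setT f) (f1 : forall x, `|f x| <= 1) (m : R) :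
    (forall C, measurable C -> (\int[P]_w (f (theta * S k w) * \1_(G (upd C)) w) = m * p (upd C))%R) ->
    forall h : R -> R, measurable_fun setT h -> (forall x, `|h x| <= 1) ->
    (\int[P]_w (W f w * h (Y ik w)) = m * p B * \int[P]_w h (Y ik w))%R.
  move=> H h mh h1.
  apply: (@expectation_factor (W f) (Y ik) (m * p B) 1 _ _ _ _ h 1) => //.
  - apply: measurable_funM; last by apply: measurable_indic; exact: mG.
    by apply: measurableT_comp => //; apply: measurable_funM.
  - move=> w; rewrite normrM -[leRHS]mulr1 ler_pM//.
    by rewrite indicE; case: (_ \in _); rewrite ?normr1 ?normr0.
  - move=> C mC; rewrite Rintegral_indic_comp// -mulrA -pE -H//.
    by apply: eq_Rintegral => w _; rewrite GE indicI/= -mulrA.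
have mct : measurable_fun setT (fun x => cos (theta * a ik * x)).
  by apply: measurableT_comp measurable_cos _; exact: measurable_funM.
have mst : measurable_fun setT (fun x => sin (theta * a ik * x)).
  by apply: measurableT_comp measurable_sin _; exact: measurable_funM.
have Hc C : measurable C -> (\int[P]_w (cos (theta * S k w) * \1_(G (upd C)) w) = e k * p (upd C))%R.
  by move=> mC; have [] := IH (upd C) (fun i => mupd C i mC) (updT C).
have Hs C : measurable C -> (\int[P]_w (sin (theta * S k w) * \1_(G (upd C)) w) = 0 * p (upd C))%R.
  by move=> mC; rewrite mul0r; have [] := IH (upd C) (fun i => mupd C i mC) (updT C).
(* The addition formulas produce these four products. The sine of the partial sum contributes 0 by
   induction and the sine of [Y_k] has mean 0, so only the product of the cosines survives. *)
have fcc := fac cos measurable_cos (@cos_max R) _ Hc _ mct (fun x => cos_max _).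
have fcs := fac cos measurable_cos (@cos_max R) _ Hc _ mst (fun x => sin_max _).
have fsc := fac sin measurable_sin (@sin_max R) _ Hs _ mct (fun x => cos_max _).
have fss := fac sin measurable_sin (@sin_max R) _ Hs _ mst (fun x => sin_max _).
have [ycos ysin] := (SaSP alpha (c ik) (Y ik)).1 (Yc ik) (theta * a ik).
rewrite ycos in fcc; rewrite ysin mulr0 in fcs; rewrite !mul0r in fsc fss.
have iW (f h : R -> R) : measurable_fun setT f -> measurable_fun setT h ->
    (forall x, `|f x| <= 1) -> (forall x, `|h x| <= 1) ->
    P.-integrable setT (EFin \o (fun w => W f w * h (Y ik w))).
  move=> mf mh f1 h1; apply: (@bounded_integrable _ _ _ _ _ 1) => [|w].
    apply: measurable_funM; last exact: (measurableT_comp mh).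
    apply: measurable_funM; last by apply: measurable_indic; exact: mG.
    by apply: measurableT_comp => //; apply: measurable_funM.
  rewrite !normrM -[leRHS]mulr1 ler_pM// -[leRHS]mulr1 ler_pM//.
  by rewrite indicE; case: (_ \in _); rewrite ?normr1 ?normr0.
have icc := iW _ _ measurable_cos mct (@cos_max R) (fun x => cos_max _).
have ics := iW _ _ measurable_cos mst (@cos_max R) (fun x => sin_max _).
have isc := iW _ _ measurable_sin mct (@sin_max R) (fun x => cos_max _).
have iss := iW _ _ measurable_sin mst (@sin_max R) (fun x => sin_max _).
split.
- rewrite (_ : (fun w => _) = fun w => W cos w * cos (theta * a ik * Y ik w) - W sin w * sin (theta * a ik * Y ik w)); last first.
    by apply/funext => w; rewrite S1 cosD /W; ring.
  rewrite (RintegralB measurableT icc iss) fcc fss subr0 e1.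
  by rewrite mulrAC.
- rewrite (_ : (fun w => _) = fun w => W sin w * cos (theta * a ik * Y ik w) + W cos w * sin (theta * a ik * Y ik w)); last first.
    by apply/funext => w; rewrite S1 sinD /W; ring.
  by rewrite (RintegralD measurableT isc ics) fsc fcs addr0.
Qed.

Lemma charfun_independent_sum :
  (\int[P]_w cos (theta * \sum_(i < n) a i * Y i w) =
     expR (- (`|theta| `^ alpha * \sum_(i < n) `|a i| `^ alpha * c i)))%R /\
  (\int[P]_w sin (theta * \sum_(i < n) a i * Y i w) = 0)%R.
Proof.
have [] := charfun_sum_rec (leqnn n) (fun _ => measurableT) (fun _ _ => erefl).
have -> : G (fun=> setT) = setT by apply/seteqP; split.
have -> : p (fun=> setT) = 1.
  by rewrite /p big1// => i _; rewrite preimage_setT probability_setT.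
have SE w : S n w = \sum_(i < n) a i * Y i w.
  by apply: eq_bigl => i; rewrite ltn_ord.
have -> : e n = expR (- (`|theta| `^ alpha * \sum_(i < n) `|a i| `^ alpha * c i)).
  congr (expR (- _)); rewrite mulr_sumr; apply: eq_big => i; first by rewrite ltn_ord.
  by rewrite normrM powRM// mulrA.
rewrite mulr1 => hc hs; split.
- by rewrite -hc; apply: eq_Rintegral => w _; rewrite indicT mulr1 SE.
- by rewrite -[RHS]hs; apply: eq_Rintegral => w _; rewrite indicT mulr1 SE.
Qed.
End charfun_sum.

End independence.

(** * Stable integrals of simple functions *)

Lemma ae_all_seq {R : realType} d (Omega : measurableType d) (mu : {measure set Omega -> \bar R})
    (I : eqType) (s : seq I) (Q : I -> Omega -> Prop) :
  (forall i, i \in s -> {ae mu, forall w, Q i w}) ->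
  {ae mu, forall w, forall i, i \in s -> Q i w}.
Proof.
elim: s => [_|i s IH H]; first exact/aeW.
have h1 := H i (mem_head _ _).
have h2 := IH (fun j js => H j (mem_behead (s := i :: s) js)).
apply: filterS2 h1 h2 => w Qi Qs j.
by rewrite inE => /predU1P[->//|/Qs].
Qed.

Definition mk_RV {R : realType} d (Omega : measurableType d) (P : probability Omega R)
    (X : Omega -> R) (mX : measurable_fun setT X) : {RV P >-> R} :=
  HB.pack X (isMeasurableFun.Build _ _ _ _ X mX).

Section simple_integral.
Context {R : realType} d (Omega : measurableType d) (P : probability Omega R).
Context d' (T : measurableType d') (D : set T) (mu : {measure set T -> \bar R}).
Variable alpha : R.
Hypothesis alpha_gt0 : 0 < alpha.
Variable M : set T -> {RV P >-> R}.
Hypothesis M_SaS : SaS_random_measure D mu alpha M.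
Local Notation finite := (finite_subsets D mu).
Local Notation I := (simple_stable_integral M).

Lemma finite_subsets_sub A B : finite A -> measurable B -> B `<=` A -> finite B.
Proof.
move=> [mA AD muA] mB BA; split => //; first exact: subset_trans AD.
by apply: le_lt_trans muA; rewrite le_measure ?inE.
Qed.

Lemma finite_subsets0 : finite set0.
Proof. by split => //; rewrite measure0 ltry. Qed.

Lemma finite_subsetsU A B : finite A -> finite B -> finite (A `|` B).
Proof.
move=> [mA AD muA] [mB BD muB]; split; [exact: measurableU|by rewrite subUset|].
by apply: le_lt_trans (measureU2 mu mA mB) _; rewrite lte_add_pinfty.
Qed.

(** For the constant sequence of empty sets the partial sums [n * M set0] converge, so their
    differences [M set0] tend to 0. *)
Lemma random_measure0 : {ae P, forall w, M set0 w = 0}.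
Proof.
have h : finite (\bigcup_(k : nat) (set0 : set T)).
  by rewrite bigcup0//; exact: finite_subsets0.
have t : trivIset setT (fun _ : nat => set0 : set T) by apply/trivIsetP => *; rewrite set0I.
have := random_measure_sigma_additive M_SaS (fun _ => finite_subsets0) t h.
rewrite bigcup0//; apply: filterS => w cw.
have cw1 : \sum_(0 <= k < n.+1) M set0 w @[n --> \oo] --> M set0 w.
  by rewrite (cvg_shiftS (fun n => \sum_(0 <= k < n) M set0 w)).
have := cvgB cw1 cw; rewrite subrr.
rewrite (_ : _ - _ = fun=> M set0 w) => [c0|].
  have c1 : M set0 w @[_ --> \oo] --> M set0 w by exact: cvg_cst.
  exact: (cvg_unique (@norm_hausdorff _ _) c1 (c0 _)).
by apply/funext => n; rewrite -[LHS]/(\sum_(0 <= k < n.+1) M set0 w - \sum_(0 <= k < n) M set0 w) big_nat_recr//= addrAC subrr add0r.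
Qed.

(** Countable additivity for the sequence [A, B, set0, set0, ...], whose empty terms vanish almost
    surely. *)
Lemma random_measureU A B : finite A -> finite B -> A `&` B = set0 ->
  {ae P, forall w, M (A `|` B) w = M A w + M B w}.
Proof.
move=> fA fB AB0.
have f2 k : finite (bigcup2 A B k).
  by case: k => [|[|k]] //=; exact: finite_subsets0.
have t2 : trivIset setT (bigcup2 A B) by rewrite -trivIset_bigcup2.
have fU : finite (\bigcup_k bigcup2 A B k) by rewrite bigcup2E; exact: finite_subsetsU.
have := random_measure_sigma_additive M_SaS f2 t2 fU; rewrite bigcup2E.
apply: filterS2 random_measure0 => w M0 cw.
have c2 : \sum_(0 <= k < n) M (bigcup2 A B k) w @[n --> \oo] --> M A w + M B w.
  apply: cvg_near_cst; near=> n.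
  have n2 : (2 <= n)%N by near: n; exact: nbhs_infty_ge.
  rewrite -(subnK n2) addn2 !big_nat_recl//= big1 ?addr0//.
exact: (cvg_unique (@norm_hausdorff _ _) cw c2).
Unshelve. all: by end_near.
Qed.

Lemma random_measure_bigsetU (J : choiceType) (s : seq J) (A : J -> set T) :
  uniq s -> trivIset setT A -> (forall j, j \in s -> finite (A j)) ->
  finite (\big[setU/set0]_(j <- s) A j) /\
  {ae P, forall w, M (\big[setU/set0]_(j <- s) A j) w = \sum_(j <- s) M (A j) w}.
Proof.
move=> + tA; elim: s => [_ _|j s IH /= /andP[js us] fA].
  rewrite big_nil; split; first exact: finite_subsets0.
  by apply: filterS random_measure0 => w; rewrite big_nil.
have [fs Ms] := IH us (fun k ks => fA k (mem_behead (s := j :: s) ks)).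
have fj := fA j (mem_head _ _).
rewrite big_cons; split; first exact: finite_subsetsU.
have dis : A j `&` \big[setU/set0]_(k <- s) A k = set0.
  apply/seteqP; split => // w [Ajw]; rewrite -bigcup_seq => -[k /= ks Akw].
  have jk : j = k by apply: (tA j k) => //; exists w.
  by rewrite jk ks in js.
apply: filterS2 Ms (random_measureU fj fs dis) => w e1 e2.
by rewrite e2 e1 big_cons.
Qed.

Section representation.
Context (J : finType) (A : J -> set T) (a : J -> R).
Hypothesis tA : trivIset setT A.
Hypothesis fA : forall j, a j != 0 -> finite (A j).
Variable f : {sfun T >-> R}.
Hypothesis fE : forall x, f x = \sum_j a j * \1_(A j) x.

Let f_in j x : A j x -> f x = a j.
Proof.
move=> Ajx; rewrite fE (bigD1 j)//= big1 => [|k kj]; rewrite indicE.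
  by rewrite mem_set// mulr1 addr0.
rewrite memNset ?mulr0// => Akx; move/eqP: kj; apply.
by apply: (tA _ _) => //; exists x.
Qed.

Let f_out x : f x != 0 -> exists j, A j x.
Proof.
apply: contraPP => nA; rewrite fE big1 ?eqxx// => j _.
by rewrite indicE memNset ?mulr0// => Ajx; apply: nA; exists j.
Qed.

Let preimE y : y != 0 -> f @^-1` [set y] = \big[setU/set0]_(j <- [seq j <- enum J | a j == y]) A j.
Proof.
move=> y0; rewrite -bigcup_seq; apply/seteqP; split => [x /= fx|x [j]].
  have [|j Ajx] := @f_out x; first by rewrite fx.
  exists j => //=; rewrite mem_filter mem_enum andbT.
  by rewrite -(f_in Ajx) fx.
by rewrite /= mem_filter => /andP[/eqP <- _]; exact: f_in.
Qed.

Lemma integrable_simple_repr : integrable_simple D mu f.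
Proof.
move=> y y0; rewrite preimE//.
have [|//|?|//] := @random_measure_bigsetU _ [seq j <- enum J | a j == y] A.
  by rewrite filter_uniq// enum_uniq.
by rewrite mem_filter => /andP[/eqP e _]; apply: fA; rewrite e.
Qed.

(** The integral sums over the values of [f], whereas the [a j] may repeat or vanish. Grouping the
    disjoint [A j] by value and using additivity of [M] identifies the two sums. *)
Lemma simple_stable_integral_repr :
  {ae P, forall w, I f w = \sum_j a j * M (A j) w}.
Proof.
pose V := undup [seq y <- codom a | y != 0].
have V0 y : y \in V -> y != 0 by rewrite mem_undup mem_filter => /andP[].
have MV : {ae P, forall w, forall y, y \in V ->
    M (f @^-1` [set y]) w = \sum_(j <- enum J | a j == y) M (A j) w}.
  apply: ae_all_seq => y yV; rewrite preimE ?V0//.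
  have [|//|j|_] := @random_measure_bigsetU _ [seq j <- enum J | a j == y] A.
  - by rewrite filter_uniq// enum_uniq.
  - by rewrite mem_filter => /andP[/eqP e _]; apply: fA; rewrite e V0.
  - by apply: filterS => w ->; rewrite big_filter.
apply: filterS2 MV random_measure0 => w Mw M0.
(* [V] may contain values that [f] does not take, when [A j] is empty; these contribute a multiple
   of [M set0], almost surely 0. *)
rewrite /simple_stable_integral (fsbig_widen _ [set` V]); last 2 first.
- move=> y [[x _ <-] /= fx0]; rewrite mem_undup mem_filter.
  have fx : f x != 0 by apply/eqP.
  rewrite fx/=; have [j Ajx] := f_out fx.
  by rewrite (f_in Ajx); exact: codom_f.
- move=> y [/= yV yf].
  rewrite preimage10 ?M0 ?mulr0// => yr; apply: yf; split => //= y0.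
  by have := V0 _ yV; rewrite y0 eqxx.
rewrite -fsbig_seq ?undup_uniq//.
rewrite (eq_big_seq (fun y => \sum_j (if a j == y then y * M (A j) w else 0))); last first.
  by move=> y yV; rewrite Mw// mulr_sumr big_enum_cond big_mkcond.
rewrite exchange_big/=; apply: eq_bigr => j _.
have [aj0|aj0] := eqVneq (a j) 0.
  rewrite aj0 mul0r big1_seq// => y /= yV.
  by have := V0 _ yV; rewrite eq_sym => /negbTE ->.
rewrite (bigD1_seq (a j)) ?undup_uniq//=.
  by rewrite eqxx big1 ?addr0// => y /negbTE; rewrite eq_sym => ->.
by rewrite mem_undup mem_filter aj0 codom_f.
Qed.

End representation.

(** Intersecting the level sets of [f] and [g] represents [f], [g] and [h] over the same disjoint
    pieces. A piece where [h] is nonzero has a nonzero value of [f] or of [g], hence finite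
    measure. *)
Lemma simple_stable_integral_linear (k : R) (f g h : {sfun T >-> R}) :
  integrable_simple D mu f -> integrable_simple D mu g ->
  (forall x, h x = k * f x + g x) ->
  integrable_simple D mu h /\ {ae P, forall w, I h w = k * I f w + I g w}.
Proof.
move=> sf sg hE.
pose rf : seq R := fset_set (range f).
pose rg : seq R := fset_set (range g).
have frf x : f x \in rf by rewrite in_fset_set ?mem_set//; exists x.
have grg x : g x \in rg by rewrite in_fset_set ?mem_set//; exists x.
pose J := (seq_sub rf * seq_sub rg)%type.
pose A (j : J) := f @^-1` [set ssval j.1] `&` g @^-1` [set ssval j.2].
have tA : trivIset setT A.
  move=> [[i1 h1] [i2 h2]] [[j1 h3] [j2 h4]] _ _ [x /= [[/= e1 e2] [/= e3 e4]]].
  by congr (_, _); apply: val_inj => /=; rewrite -?e1 -?e2 ?e3 ?e4.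
have mA j : measurable (A j).
  by apply: measurableI; exact: measurable_funPTI.
have fA1 j : ssval j.1 != 0 -> finite (A j).
  by move=> j0; apply: finite_subsets_sub (sf _ j0) (mA j) _ => x [].
have fA2 j : ssval j.2 != 0 -> finite (A j).
  by move=> j0; apply: finite_subsets_sub (sg _ j0) (mA j) _ => x [].
have AE x (a : J -> R) : \sum_j a j * \1_(A j) x = a (SeqSub (frf x), SeqSub (grg x)).
  rewrite (bigD1 (SeqSub (frf x), SeqSub (grg x)))//= big1 => [|j jx].
    by rewrite indicE mem_set ?mulr1 ?addr0.
  rewrite indicE memNset ?mulr0// => -[/= e1 e2]; move/eqP: jx; apply.
  by case: j e1 e2 => -[j1 ?] [j2 ?] /= e1 e2; congr (_, _); apply: val_inj.
have fAh j : k * ssval j.1 + ssval j.2 != 0 -> finite (A j).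
  have [->|/fA1//] := eqVneq (ssval j.1) 0.
  by rewrite mulr0 add0r; exact: fA2.
have hf := @simple_stable_integral_repr J A (fun j => ssval j.1) tA fA1 f (fun x => esym (AE x _)).
have hg := @simple_stable_integral_repr J A (fun j => ssval j.2) tA fA2 g (fun x => esym (AE x _)).
have hhE x : h x = \sum_j (k * ssval j.1 + ssval j.2) * \1_(A j) x.
  by rewrite (AE x (fun j => k * ssval j.1 + ssval j.2)) hE.
have hh := @simple_stable_integral_repr J A (fun j => k * ssval j.1 + ssval j.2) tA fAh h hhE.
split; first exact: (@integrable_simple_repr J A (fun j => k * ssval j.1 + ssval j.2)).
apply: filterS3 hf hg hh => w -> -> ->.
rewrite mulr_sumr -big_split; apply: eq_bigr => j _ /=.
by rewrite mulrDl mulrA.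
Qed.

(** The nonzero values as a list, so that level sets are indexed by ordinals as in the independence
    clause of [SaS_random_measure]. *)
Let nzrange (f : {sfun T >-> R}) : seq R := [seq y <- fset_set (range f) | y != 0].

Let uniq_nzrange f : uniq (nzrange f).
Proof. by rewrite filter_uniq//; exact: fset_uniq. Qed.

Let simple_stable_integralE f w :
  I f w = \sum_(i < size (nzrange f)) (nzrange f)`_i * M (f @^-1` [set (nzrange f)`_i]) w.
Proof.
rewrite -(big_mkord xpredT (fun i => (nzrange f)`_i * M (f @^-1` [set (nzrange f)`_i]) w)).
rewrite -(big_nth 0 xpredT (fun y => y * M (f @^-1` [set y]) w)).
rewrite /simple_stable_integral (_ : range f `\ 0 = [set` nzrange f]) -?fsbig_seq ?uniq_nzrange//.
apply/seteqP; split => y /=.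
  by move=> [yr /eqP y0]; rewrite mem_filter y0 in_fset_set ?mem_set.
by rewrite mem_filter => /andP[/eqP y0]; rewrite in_fset_set// inE.
Qed.

Lemma measurable_simple_stable_integral f : measurable_fun setT (I f).
Proof.
rewrite (_ : I f = fun w => \sum_(i < size (nzrange f)) (nzrange f)`_i *
    M (f @^-1` [set (nzrange f)`_i]) w); last by apply/funext => w; exact: simple_stable_integralE.
by apply: measurable_sum => i; exact: measurable_funM.
Qed.

Lemma integral_simple_powR f : integrable_simple D mu f ->
  (\int[mu]_(x in D) (`|f x| `^ alpha)%:E =
   (\sum_(i < size (nzrange f)) `|(nzrange f)`_i| `^ alpha *
      fine (mu (f @^-1` [set (nzrange f)`_i])))%:E)%E.
Proof.
move=> sf.
have nz (i : 'I_(size (nzrange f))) : (nzrange f)`_i != 0.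
  by have := mem_nth 0 (ltn_ord i); rewrite mem_filter => /andP[].
have fx0 x : f x != 0 -> D x.
  by move=> /sf[_ + _]; apply.
(* Nonzero level sets of [f] lie in [D], so [f] vanishes outside [D] and the restriction
   disappears. *)
have -> : (\int[mu]_(x in D) (`|f x| `^ alpha)%:E = \int[mu]_x (`|f x| `^ alpha)%:E)%E.
  rewrite integral_mkcond; apply: eq_integral => x _; rewrite patchE.
  case: ifPn => // xD; have [->|/fx0 Dx] := eqVneq (f x) 0.
    by rewrite normr0 powR0// gt_eqF.
  by rewrite notin_setE in xD.
have -> : (\int[mu]_x (`|f x| `^ alpha)%:E = \int[mu]_x
    \sum_(y <- nzrange f) (`|y| `^ alpha * \1_(f @^-1` [set y]) x)%:E)%E.
  apply: eq_integral => x _; rewrite sumEFin; congr EFin.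
  have [fx|fx] := eqVneq (f x) 0.
    rewrite fx normr0 powR0 ?gt_eqF// big1_seq// => y /= yf.
    rewrite indicE memNset ?mulr0//= fx => y0.
    by move: yf; rewrite mem_filter -y0 eqxx.
  rewrite (bigD1_seq (f x)) ?uniq_nzrange//=.
    rewrite indicE mem_set// mulr1 big1 ?addr0// => y yf.
    by rewrite indicE memNset ?mulr0//= => fy; rewrite fy eqxx in yf.
  by rewrite mem_filter fx in_fset_set ?mem_set//; exists x.
have mf y : measurable (f @^-1` [set y]) by exact: measurable_funPTI.
rewrite ge0_integral_sum//; last first.
  by move=> y; apply/measurable_EFinP; apply: measurable_funM => //; exact: measurable_indic.
rewrite (big_nth 0) big_mkord -sumEFin; apply: eq_bigr => i _.
under eq_integral do rewrite EFinM.
rewrite ge0_integralZl//; last first.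
  by apply/measurable_EFinP; exact: measurable_indic.
rewrite integral_indic// setIT EFinM fineK//.
by have [_ _ muf] := sf _ (nz i); rewrite ge0_fin_numE.
Qed.

(** Level sets are disjoint, so [M] takes independent stable values on them; the scale of their
    combination is the sum that computes the modular. *)
Lemma simple_stable_integral_SaS f : integrable_simple D mu f ->
  SaS alpha (fine (\int[mu]_(x in D) (`|f x| `^ alpha)%:E)%E)
    (mk_RV P (measurable_simple_stable_integral f)).
Proof.
move=> sf; rewrite integral_simple_powR//=; apply/SaSP => theta.
pose n := size (nzrange f).
pose A (i : 'I_n) := f @^-1` [set (nzrange f)`_i].
have fA i : finite (A i).
  by apply: sf; have := mem_nth 0 (ltn_ord i); rewrite mem_filter => /andP[].
have tA : trivIset setT A.
  move=> i j _ _ [w [/= e1 e2]]; apply/val_inj/eqP => /=.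
  by rewrite -(nth_uniq 0 (ltn_ord i) (ltn_ord j) (uniq_nzrange f)) -e1 -e2.
have [hc hs] := @charfun_independent_sum _ _ _ P alpha n (M \o A)
  (fun i => (nzrange f)`_i) (fun i => fine (mu (A i))) theta
  (random_measure_independently_scattered M_SaS fA tA)
  (fun i => random_measure_SaS M_SaS (fA i)).
split.
- rewrite -hc; apply: eq_Rintegral => w _ /=; congr (cos (_ * _)); exact: simple_stable_integralE.
- rewrite -[RHS]hs; apply: eq_Rintegral => w _ /=; congr (sin (_ * _)); exact: simple_stable_integralE.
Qed.

End simple_integral.

(** * Stable integrals on L^alpha *)

Section powR.
Context {R : realType}.
Variable alpha : R.
Hypothesis alpha_gt0 : 0 < alpha.

Lemma powR_norm_le (a b k : R) : 0 <= k -> `|a| <= k * `|b| ->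
  `|a| `^ alpha <= k `^ alpha * `|b| `^ alpha.
Proof.
move=> k0 ab; rewrite -powRM// ge0_ler_powR ?nnegrE ?(ltW alpha_gt0)//.
by rewrite mulr_ge0.
Qed.

(** If [|b| <= delta |a|] the sum is at most [(1 + delta) |a|]; otherwise [|a| < |b| / delta] and it
    is at most [(1 + 1/delta) |b|]. This holds for every [alpha > 0], and the first constant tends
    to 1 with [delta]. *)
Lemma powR_normD (delta a b : R) : 0 < delta ->
  `|a + b| `^ alpha <=
  (1 + delta) `^ alpha * `|a| `^ alpha + (1 + delta^-1) `^ alpha * `|b| `^ alpha.
Proof.
move=> d0; have [ba|ab] := leP `|b| (delta * `|a|).
  apply: (@le_trans _ _ ((1 + delta) `^ alpha * `|a| `^ alpha)).
    apply: powR_norm_le; first by rewrite addr_ge0// ltW.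
    by rewrite (le_trans (ler_normD _ _))// mulrDl mul1r lerD2l.
  by rewrite lerDl mulr_ge0 ?powR_ge0.
apply: (@le_trans _ _ ((1 + delta^-1) `^ alpha * `|b| `^ alpha)).
  apply: powR_norm_le; first by rewrite addr_ge0// invr_ge0 ltW.
  rewrite (le_trans (ler_normD _ _))// mulrDl mul1r addrC lerD2l.
  by rewrite mulrC ler_pdivlMr// mulrC ltW.
by rewrite lerDr mulr_ge0 ?powR_ge0.
Qed.

Lemma powR_cvg0_seq (u : nat -> R) : (forall n, 0 <= u n) ->
  u n @[n --> \oo] --> 0 -> u n `^ alpha @[n --> \oo] --> 0.
Proof.
move=> u0 /cvgrPdist_lt cu; apply/cvgrPdist_lt => e e0.
have := cu (e `^ alpha^-1); rewrite powR_gt0// => /(_ isT); apply: filterS => n.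
rewrite !sub0r !normrN !ger0_norm ?powR_ge0// => un.
rewrite -[ltRHS]powRr1 ?(ltW e0)// -(@mulVf _ alpha) ?gt_eqF// powRrM.
by rewrite gt0_ltr_powR ?nnegrE ?powR_ge0.
Qed.

Lemma cvg_of_powR_bounds (c : R) (c_ e_ : nat -> R) : 
  (forall delta, 0 < delta -> forall n,
     c_ n <= (1 + delta) `^ alpha * c + (1 + delta^-1) `^ alpha * e_ n /\
     c <= (1 + delta) `^ alpha * c_ n + (1 + delta^-1) `^ alpha * e_ n) ->
  alpha < 2 -> 0 <= c -> (forall n, 0 <= e_ n) -> (forall n, 0 <= c_ n) ->
  e_ n @[n --> \oo] --> 0 -> c_ n @[n --> \oo] --> c.
Proof.
move=> H alpha2 c0 e0 c_0 ce; apply/cvgrPdist_lt => eps eps0.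
have c1 : 0 < 24 * (c + 1) by rewrite mulr_gt0// ltr_wpDl.
(* With [delta <= 1] and [alpha < 2] one has [(1 + delta)^alpha <= 1 + 3 delta]. Inserting the first
   bound into the second gives [c - c_n <= 12 delta c + 4 K e_n], where [K = (1 + 1/delta)^alpha].
   The constants 24 and [4 K] make each term at most [eps / 2]. *)
pose delta := Num.min 1 (eps / (24 * (c + 1))).
have d0 : 0 < delta by rewrite lt_min ltr01 divr_gt0.
have d1 : delta <= 1 by rewrite ge_min lexx.
have d2 : 12 * delta * c <= eps / 2.
  have : delta <= eps / (24 * (c + 1)) by rewrite ge_min lexx orbT.
  rewrite ler_pdivlMr// => h.
  have : 0 <= delta by exact: ltW.
  nra.
have pw : (1 + delta) `^ alpha <= 1 + 3 * delta.
  apply: (@le_trans _ _ ((1 + delta) `^ 2)).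
    by apply: ler_powR; [rewrite lerDl ltW|exact: ltW].
  by rewrite powR_mulrn ?addr_ge0 ?(ltW d0)//; nra.
pose K := (1 + delta^-1) `^ alpha.
have K0 : 0 < K by rewrite powR_gt0// addr_gt0// invr_gt0.
have /cvgrPdist_lt/(_ (eps / 2 / (4 * K))) := ce.
rewrite !divr_gt0// ?mulr_gt0// => /(_ isT); apply: filterS => n.
rewrite sub0r normrN ger0_norm// ltr_pdivlMr ?mulr_gt0// => he.
have [h1 h2] := H delta d0 n.
have hc := c_0 n; have hen := e0 n.
have h1' : c_ n <= (1 + 3 * delta) * c + K * e_ n.
  by apply: le_trans h1 _; rewrite lerD2r ler_wpM2r.
have h2' : c <= (1 + 3 * delta) * c_ n + K * e_ n.
  by apply: le_trans h2 _; rewrite lerD2r ler_wpM2r.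
have Ke : 0 <= K * e_ n by rewrite mulr_ge0// ltW.
have dc : 0 <= delta * c by rewrite mulr_ge0// ltW.
have dd : delta * (delta * c) <= delta * c by rewrite ler_piMl.
have dK : delta * (K * e_ n) <= K * e_ n by rewrite ler_piMl.
have dcn : delta * c_ n <= delta * ((1 + 3 * delta) * c + K * e_ n) by rewrite ler_wpM2l// ltW.
rewrite ltr_norml; apply/andP; split; nra.
Qed.

End powR.

(** The [alpha]-th power of the [L^alpha] norm on [D], kept without the root because it is the scale
    of the stable integral and because the root is not a norm when [alpha < 1]. *)
HB.lock Definition modular {R : realType} d' (T : measurableType d') (D : set T)
    (mu : {measure set T -> \bar R}) (alpha : R) (f : T -> R) : \bar R :=
  (\int[mu]_(x in D) (`|f x| `^ alpha)%:E)%E.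

Arguments modular {R d' T} D mu alpha f.

Lemma modularE {R : realType} d' (T : measurableType d') (D : set T)
    (mu : {measure set T -> \bar R}) (alpha : R) (f : T -> R) :
  modular D mu alpha f = (\int[mu]_(x in D) (`|f x| `^ alpha)%:E)%E.
Proof. by rewrite modular.unlock. Qed.

Section stable_integral.
Context {R : realType} d (Omega : measurableType d) (P : probability Omega R).
Context d' (T : measurableType d') (D : set T) (mu : {measure set T -> \bar R}).
Variable alpha : R.
Hypothesis mD : measurable D.
Hypothesis alpha_gt0 : 0 < alpha.
Hypothesis alpha_lt2 : alpha < 2.
Variable M : set T -> {RV P >-> R}.
Hypothesis M_SaS : SaS_random_measure D mu alpha M.
Local Notation I := (simple_stable_integral M).
Local Notation N f := (modular D mu alpha f%R).
Implicit Types f g : T -> R.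

Let mpow f : measurable_fun D f -> measurable_fun D (fun x => (`|f x| `^ alpha)%:E).
Proof.
move=> mf; apply/measurable_EFinP.
apply: (measurableT_comp (measurable_powR alpha)).
by apply: measurableT_comp mf.
Qed.

Let N_ge0 f : (0 <= N f)%E.
Proof. by rewrite modularE; apply: integral_ge0 => x _; rewrite lee_fin powR_ge0. Qed.

Lemma restrict_LfunP f : (f \_ D) \in Lfun mu alpha%:E <-> measurable_fun D f /\ (N f < +oo)%E.
Proof.
have a0 : alpha != 0 by rewrite gt_eqF.
have E : (('N[mu]_alpha%:E [EFin \o (f \_ D)]) `^ alpha = N f)%E.
  rewrite powR_Lnorm; last by [].
  rewrite !modularE [RHS]integral_mkcond.
  apply: eq_integral => x _.
  rewrite -[(EFin \o _) x]/((f \_ D) x)%:E abse_EFin poweR_EFin !patchE; case: ifP => // _.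
  by rewrite normr0 powR0.
split.
  move=> /andP[]; rewrite !inE/= => mf fN; split.
    exact/(measurable_restrictT _ mD).2.
  by rewrite -E poweR_lty.
move=> [mf Nf]; apply/andP; split; rewrite inE/=.
  exact/(measurable_restrictT _ mD).1.
by rewrite /finite_norm; apply: (@lty_poweRy _ _ alpha) => //; rewrite E.
Qed.

Lemma eq_integral_powR f g : (forall x, D x -> f x = g x) -> N f = N g.
Proof. by move=> fg; rewrite !modularE; apply: eq_integral => x /[!inE] Dx; rewrite fg. Qed.

Lemma integral_powRD (delta : R) f g : 0 < delta ->
  measurable_fun D f -> measurable_fun D g ->
  (N (fun x => f x + g x) <=
   ((1 + delta) `^ alpha)%:E * N f + ((1 + delta^-1) `^ alpha)%:E * N g)%E.
Proof.
move=> d0 mf mg.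
rewrite !modularE -!ge0_integralZl//; try (by rewrite lee_fin powR_ge0); try (exact: mpow);
  try (by move=> x _; rewrite lee_fin powR_ge0).
rewrite -ge0_integralD//; last 4 first.
- by move=> x _; rewrite mule_ge0// lee_fin powR_ge0.
- by apply: measurable_funeM; exact: mpow.
- by move=> x _; rewrite mule_ge0// lee_fin powR_ge0.
- by apply: measurable_funeM; exact: mpow.
apply: ge0_le_integral => //.
- by apply: mpow; exact: measurable_funD.
- by apply: emeasurable_funD; apply: measurable_funeM; exact: mpow.
- by move=> x _; rewrite -!EFinM -EFinD lee_fin; exact: powR_normD.
Qed.

Lemma integral_powRZ (k : R) f : measurable_fun D f ->
  N (fun x => k * f x) = ((`|k| `^ alpha)%:E * N f)%E.
Proof.
move=> mf; rewrite !modularE -ge0_integralZl//; last exact: mpow.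
by apply: eq_integral => x _; rewrite normrM powRM.
Qed.

Lemma integral_powR_linear_fin (k : R) f g :
  measurable_fun D f -> measurable_fun D g -> (N f < +oo)%E -> (N g < +oo)%E ->
  (N (fun x => k * f x + g x) < +oo)%E.
Proof.
move=> mf mg Nf Ng.
apply: le_lt_trans (@integral_powRD 1 (fun x => k * f x) g ltr01 _ mg) _.
  exact: measurable_funM.
rewrite integral_powRZ// lte_add_pinfty// lte_mul_pinfty ?mule_ge0 ?lee_fin ?powR_ge0//.
by rewrite lte_mul_pinfty ?lee_fin ?powR_ge0.
Qed.

Let msfun (h : {sfun T >-> R}) : measurable_fun D h.
Proof. by apply: measurable_funTS; exact: measurable_funP. Qed.

Let simple_fin (h : {sfun T >-> R}) : integrable_simple D mu h -> (N h < +oo)%E.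
Proof. by move=> sh; rewrite !modularE integral_simple_powR// ltry. Qed.

(** Both [f_n = f + (f_n - f)] and [f = f_n - (f_n - f)] are estimated for every [delta], which
    bounds each modular by nearly the other. *)
Lemma cvg_integral_powR (f_ : nat -> {sfun T >-> R}) f :
  (forall n, integrable_simple D mu (f_ n)) -> measurable_fun D f -> (N f < +oo)%E ->
  N (fun x => f_ n x - f x) @[n --> \oo] --> 0%E ->
  fine (N (f_ n)) @[n --> \oo] --> fine (N f).
Proof.
move=> sf mf Nf cf.
have fin g : (N g < +oo)%E -> N g \is a fin_num by rewrite ge0_fin_numE.
have md n : measurable_fun D (fun x => f_ n x - f x) by apply: measurable_funB.
have Nd n : (N (fun x => f_ n x - f x) < +oo)%E.
  have := integral_powR_linear_fin (-1) mf (msfun (f_ n)) Nf (simple_fin (sf n)).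
  by congr (_ < _)%E; apply: eq_integral_powR => x _; rewrite mulN1r addrC.
apply: (@cvg_of_powR_bounds _ alpha _ _ (fun n => fine (N (fun x => f_ n x - f x)))) => //.
- move=> delta d0 n; split.
    rewrite -lee_fin EFinD !EFinM !fineK ?fin ?simple_fin//.
    apply: le_trans (integral_powRD d0 mf (md n)).
    by rewrite (@eq_integral_powR (f_ n) (fun x => f x + (f_ n x - f x))) => [//|x _]; rewrite addrC subrK.
  rewrite -lee_fin EFinD !EFinM !fineK ?fin ?simple_fin//.
  have mNd : measurable_fun D (fun x => -1 * (f_ n x - f x)) by apply: measurable_funM.
  have := integral_powRD d0 (msfun (f_ n)) mNd.
  rewrite (integral_powRZ _ (md n)) normrN normr1 powR1 mul1e.
  apply: le_trans.
  by rewrite (@eq_integral_powR f (fun x => f_ n x + -1 * (f_ n x - f x))) => [//|x _]; ring.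
- by rewrite fine_ge0.
- by move=> n; rewrite fine_ge0.
- by move=> n; rewrite fine_ge0.
- exact: (fine_cvg cf).
Qed.

(* [is_stable_integral] without the requirement that f be in L^alpha. *)
Definition stable_limit f (Y : {RV P >-> R}) := exists f_ : nat -> {sfun T >-> R},
  [/\ forall n, integrable_simple D mu (f_ n),
      N (fun x => f_ n x - f x) @[n --> \oo] --> 0%E &
      cvg_in_probability P (fun n => I (f_ n)) Y].

Lemma stable_limitP f Y : stable_limit f Y <-> exists f_ : nat -> {sfun T >-> R},
  [/\ forall n, integrable_simple D mu (f_ n),
      (\int[mu]_(x in D) (`|f_ n x - f x| `^ alpha)%:E)%E @[n --> \oo] --> 0%E &
      cvg_in_probability P (fun n => I (f_ n)) Y].
Proof.
have E (f_ : nat -> {sfun T >-> R}) : (fun n => N (fun x => f_ n x - f x)) =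
    (fun n => (\int[mu]_(x in D) (`|f_ n x - f x| `^ alpha)%:E)%E).
  by apply/funext => n; rewrite modularE.
by split=> -[f_ [sf cf cY]]; exists f_; split => //; [rewrite -E|rewrite E].
Qed.

Lemma stable_limit_SaS f Y : measurable_fun D f -> (N f < +oo)%E ->
  stable_limit f Y -> SaS alpha (fine (N f)) Y.
Proof.
move=> mf Nf [f_ [sf cf cY]].
apply: (@SaS_cvg _ _ _ P alpha (fun n => mk_RV P (measurable_simple_stable_integral M (f_ n)))
  (fun n => fine (N (f_ n)))) => //.
  by move=> n; rewrite modularE; apply: (simple_stable_integral_SaS alpha_gt0 M_SaS).
exact: cvg_integral_powR.
Qed.

(** The approximants are [k f_n + g_n]. Their integrals are linear only almost surely, so
    convergence in probability is transferred along almost sure equalities. *)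
Lemma stable_limit_linear (k : R) f g (Y Z W : {RV P >-> R}) :
  measurable_fun D f -> measurable_fun D g ->
  (forall w, W w = k * Y w + Z w) ->
  stable_limit f Y -> stable_limit g Z -> stable_limit (fun x => k * f x + g x) W.
Proof.
move=> mf mg WE [f_ [sf cf cY]] [g_ [sg cg cZ]].
pose h_ n : {sfun T >-> R} := cst_sfun k * f_ n + g_ n.
have hE n x : h_ n x = k * f_ n x + g_ n x by [].
clearbody h_.
have lin n := simple_stable_integral_linear M_SaS (sf n) (sg n) (hE n).
have mI h : measurable_fun setT (I h) by exact: measurable_simple_stable_integral.
exists h_; split.
- by move=> n; have [] := lin n.
- have ub : (((1 + 1) `^ alpha)%:E * ((`|k| `^ alpha)%:E * N (fun x => f_ n x - f x)) +
     ((1 + 1^-1) `^ alpha)%:E * N (fun x => g_ n x - g x))%E @[n --> \oo] --> 0%E.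
    have u1 := cvgeZl (y := (`|k| `^ alpha)%:E) isT cf.
    have u2 := cvgeZl (y := ((1 + 1) `^ alpha)%:E) isT u1.
    have u3 := cvgeZl (y := ((1 + 1^-1) `^ alpha)%:E) isT cg.
    rewrite !mule0 in u2 u3; rewrite -[X in _ --> X]adde0.
    exact: (cvgeD _ u2 u3).
  apply: (squeeze_cvge _ (cvg_cst 0%E) ub); apply: nearW => n; rewrite N_ge0/=.
  have m1 : measurable_fun D (fun x => f_ n x - f x) by apply: measurable_funB.
  have m2 : measurable_fun D (fun x => g_ n x - g x) by apply: measurable_funB.
  rewrite -integral_powRZ//.
  apply: le_trans (integral_powRD ltr01 _ m2); last exact: measurable_funM.
  rewrite (@eq_integral_powR _ (fun x => k * (f_ n x - f x) + (g_ n x - g x))) => [//|x _].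
  by rewrite hE; ring.
- apply: (@cvg_in_probability_ae _ _ _ P (fun n w => k * I (f_ n) w + I (g_ n) w) _
    (fun w => k * Y w + Z w)) => //.
  + by move=> n; apply: measurable_funD => //; apply: measurable_funM.
  + by apply: measurable_funD => //; apply: measurable_funM.
  + by move=> n; have [_] := lin n; apply: filterS => w ->.
  + by apply/aeW => w; rewrite WE.
  + exact: cvg_in_probability_lin.
Qed.

(** [Z - Y] is an integral of the zero function, hence stable of scale 0. *)
Lemma stable_limit_unique f (Y Z : {RV P >-> R}) : measurable_fun D f ->
  stable_limit f Y -> stable_limit f Z -> {ae P, forall w, Y w = Z w}.
Proof.
move=> mf fY fZ.
have mW : measurable_fun setT (fun w => -1 * Y w + Z w).
  by apply: measurable_funD => //; apply: measurable_funM.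
have N0 : N (fun x => -1 * f x + f x) = 0%E.
  by rewrite modularE; apply: integral0_eq => x _; rewrite mulN1r addNr normr0 powR0// gt_eqF.
have := stable_limit_linear (W := mk_RV P mW) mf mf (fun _ => erefl) fY fZ.
move/stable_limit_SaS; rewrite N0.
have m0 : measurable_fun D (fun x => -1 * f x + f x).
  by apply: measurable_funD => //; apply: measurable_funM.
move=> /(_ m0 (ltry 0)) /(SaS_ae_eq_scale0 alpha_gt0); apply: filterS => w /= e.
by apply/eqP; rewrite eq_sym -subr_eq0 -e mulN1r addrC.
Qed.

(** Approximating the positive and negative parts from below keeps [|g_n| <= |f|] on [D] and
    [g_n = 0] outside. Dominated convergence applies with dominating function
    [2^alpha |f|^alpha]. *)
Lemma simple_approx f : measurable_fun D f -> (N f < +oo)%E ->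
  exists g : nat -> {sfun T >-> R}, (forall n, integrable_simple D mu (g n)) /\
    N (fun x => g n x - f x) @[n --> \oo] --> 0%E.
Proof.
move=> mf Nf.
pose h := f \_ D.
have mh : measurable_fun setT (EFin \o h).
  by apply/measurable_EFinP; exact/(measurable_restrictT _ mD).1.
have mhp := measurable_funepos mh; have mhn := measurable_funeneg mh.
pose p n := nnsfun_approx measurableT mhp n.
pose q n := nnsfun_approx measurableT mhn n.
pose g n : {sfun T >-> R} := (p n : {sfun T >-> R}) - (q n : {sfun T >-> R}).
have gE n x : g n x = p n x - q n x by [].
have p0 n x : 0 <= p n x by exact: fun_ge0.
have q0 n x : 0 <= q n x by exact: fun_ge0.
have ph n x : p n x <= Num.max (h x) 0.
  have := @le_approx _ _ _ setT (EFin \o h)^\+%E n x (fun x _ => funepos_ge0 _ x) Logic.I.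
  by rewrite -nnsfun_approxE funeposE/= -EFin_max lee_fin.
have qh n x : q n x <= Num.max (- h x) 0.
  have := @le_approx _ _ _ setT (EFin \o h)^\-%E n x (fun x _ => funeneg_ge0 _ x) Logic.I.
  by rewrite -nnsfun_approxE funenegE/= -EFin_max lee_fin.
have gh n x : `|g n x| <= `|h x|.
  rewrite gE; have := ph n x; have := qh n x; have := p0 n x; have := q0 n x.
  have [hx|hx] := leP 0 (h x).
    rewrite (max_idPr _) ?oppr_le0// => ? ? ? ?.
    by rewrite (ger0_norm hx) ler_norml; apply/andP; split; lra.
  rewrite (max_idPl _) ?oppr_ge0 ?(ltW hx)// => ? ? ? ?.
  by rewrite (ltr0_norm hx) ler_norml; apply/andP; split; lra.
have gcv x : g n x @[n --> \oo] --> h x.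
  have c1 := @cvg_nnsfun_approx _ _ _ setT measurableT _ mhp (fun x _ => funepos_ge0 _ x) x Logic.I.
  have c2 := @cvg_nnsfun_approx _ _ _ setT measurableT _ mhn (fun x _ => funeneg_ge0 _ x) x Logic.I.
  have {}c1 : p n x @[n --> \oo] --> Num.max (h x) 0.
    by move: c1; rewrite funeposE/= -EFin_max => /fine_cvgP[_].
  have {}c2 : q n x @[n --> \oo] --> Num.max (- h x) 0.
    by move: c2; rewrite funenegE/= -EFin_max => /fine_cvgP[_].
  have -> : h x = Num.max (h x) 0 - Num.max (- h x) 0.
    have [hx|hx] := leP 0 (h x).
      by rewrite (max_idPr _) ?oppr_le0// subr0.
    by rewrite (max_idPl _) ?oppr_ge0 ?(ltW hx)// opprK add0r.
  exact: cvgB c1 c2.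
have hD x : D x -> h x = f x by move=> Dx; rewrite /h patchE mem_set.
have hnD x : ~ D x -> h x = 0 by move=> Dx; rewrite /h patchE memNset.
exists g; split.
- move=> n y y0.
  have mA : measurable (g n @^-1` [set y]) by exact: measurable_funPTI.
  have AD : g n @^-1` [set y] `<=` D.
    move=> x /= gy; apply: contrapT => /hnD hx.
    by have := gh n x; rewrite hx normr0 normr_le0 [g n x]gy (negbTE y0).
  split => //.
  have ypos : 0 < `|y| `^ alpha by rewrite powR_gt0// normr_gt0.
  (* Markov's inequality: on the level set of [y] one has [|y| <= |f|], so its measure is finite. *)
  have : ((`|y| `^ alpha)%:E * mu (g n @^-1` [set y]) <= N f)%E.
    rewrite modularE -integral_cst//.
    apply: (@le_trans _ _ (\int[mu]_(x in g n @^-1` [set y]) (`|f x| `^ alpha)%:E)%E).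
      apply: ge0_le_integral => //.
      - by move=> x _; rewrite lee_fin powR_ge0.
      - by apply: measurable_funS (mpow mf).
      move=> x /= gy; rewrite lee_fin ge0_ler_powR ?nnegrE ?(ltW alpha_gt0)//.
      by have := gh n x; rewrite [g n x]gy hD//; exact: AD.
    by apply: ge0_subset_integral => //; exact: mpow.
  move=> /le_lt_trans /(_ Nf).
  have [->|muA _] := eqVneq (mu (g n @^-1` [set y])) +oo%E.
    by rewrite gt0_muley ?lte_fin.
  by rewrite ltey.
- have mgf n : measurable_fun D (fun x => g n x - f x) by apply: measurable_funB.
  have [|||||_ _] := @dominated_convergence _ _ _ mu D mD
    (fun n x => (`|g n x - f x| `^ alpha)%:E) (cst 0%E)
    (fun x => (2 `^ alpha)%:E * (`|f x| `^ alpha)%:E)%E.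
  + by move=> n; exact: mpow.
  + exact: measurable_cst.
  + apply/aeW => x Dx; apply/cvg_EFin; first exact: nearW.
    apply: powR_cvg0_seq => //.
    have c : `|g m x - h x| @[m --> \oo] --> `|h x - h x|.
      by apply: cvg_norm; apply: cvgB; [exact: gcv|exact: cvg_cst].
    by rewrite subrr normr0 hD in c.
  + apply/integrableP; split; first by apply: measurable_funeM; exact: mpow.
    rewrite (_ : (\int[mu]_(x in D) _)%E = ((2 `^ alpha)%:E * N f)%E).
      by rewrite lte_mul_pinfty// ?lee_fin ?powR_ge0.
    rewrite modularE -ge0_integralZl ?lee_fin ?powR_ge0//; last first.
      exact: mpow.
    apply: eq_integral => x _; rewrite gee0_abs// mule_ge0// lee_fin powR_ge0//.
  + apply/aeW => x n Dx; rewrite gee0_abs; last by rewrite lee_fin powR_ge0.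
    rewrite -EFinM lee_fin.
    apply: powR_norm_le => //.
    have := gh n x; rewrite hD// => gf.
    by rewrite (le_trans (ler_normB _ _))//; lra.
  rewrite integral0 (_ : (fun n => N (fun x => g n x - f x)) =
    (fun n => (\int[mu]_(x in D) (`|g n x - f x| `^ alpha)%:E)%E))//.
  by apply/funext => n; rewrite modularE.
Qed.

(** Along a subsequence with modulars at most [8^-n], the tail bound makes the probabilities of
    increments above [2^-n] summable, so the simple integrals converge in probability. *)
Lemma stable_limit_exists f : measurable_fun D f -> (N f < +oo)%E ->
  exists Y, stable_limit f Y.
Proof.
move=> mf Nf; have [g [sg cg]] := simple_approx mf Nf.
have b0 n : (0 < (8^-1 ^+ n : R)%:E)%E by rewrite lte_fin exprn_gt0// invr_gt0.
have ex n : exists m, (n <= m)%N /\ (N (fun x => g m x - f x) <= (8^-1 ^+ n)%:E)%E.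
  have /fine_cvgP[[m1 _ h1]] := cg.
  move=> /cvgrPdist_lt/(_ _ (exprn_gt0 n (_ : 0 < 8^-1)))[|m2 _ h2]; first by rewrite invr_gt0.
  exists (maxn n (maxn m1 m2)); split; first exact: leq_maxl.
  have l1 : (m1 <= maxn n (maxn m1 m2))%N by rewrite !leq_max leqnn orbT.
  have l2 : (m2 <= maxn n (maxn m1 m2))%N by rewrite !leq_max leqnn !orbT.
  have := h2 _ l2; rewrite /= sub0r normrN ger0_norm ?fine_ge0// => h.
  by rewrite -[leLHS]fineK ?h1// lee_fin ltW.
have [phi phiP] := choice ex.
pose F n := g (phi n).
have sF n : integrable_simple D mu (F n) by exact: sg.
have hE n x : (cst_sfun (-1) * F n + F n.+1 : {sfun T >-> R}) x = -1 * F n x + F n.+1 x by [].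
have lin n := simple_stable_integral_linear M_SaS (sF n) (sF n.+1) (hE n).
pose X n := mk_RV P (measurable_simple_stable_integral M (F n)).
have md n : measurable_fun D (fun x => F n x - f x) by apply: measurable_funB.
(* The increment has scale at most [2^alpha (8^-n + 8^-n) <= 8 * 8^-n], and
   [(2 / 2^-n)^alpha <= 4 * 4^n]. The bound is [2 * 4 * 4^n * 8 * 8^-n = 64 / 2^n], written to match
   the geometric series of [epsilon_trick0]. *)
have tail n : (P [set w | (2^-1 ^+ n <= `|X n.+1 w - X n w|)%R] <= (128 / (2 ^ n.+1)%:R)%:E)%E.
  have [sh hI] := lin n.
  have mdX : measurable_fun setT (fun w => X n.+1 w - X n w) by exact: measurable_funB.
  have := simple_stable_integral_SaS alpha_gt0 M_SaS sh; rewrite -modularE.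
  move=> /(@SaS_ae_eq _ _ _ P alpha _ _ (mk_RV P mdX)) /=.
  have e : {ae P, forall w, I (cst_sfun (-1) * F n + F n.+1) w = X n.+1 w - X n w}.
    by apply: filterS hI => w ->; rewrite mulN1r addrC.
  move=> /(_ e) /SaS_tail tl.
  have h0 : 0 < 2^-1 ^+ n :> R by rewrite exprn_gt0// invr_gt0.
  have := tl alpha_gt0 _ _ h0; rewrite fine_ge0// => /(_ isT) /le_trans; apply.
  rewrite lee_fin.
  have Nh : (N (fun x => (cst_sfun (-1) * F n + F n.+1 : {sfun T >-> R}) x) <= (8 * 8^-1 ^+ n)%:E)%E.
    have mNd : measurable_fun D (fun x => -1 * (F n x - f x)) by apply: measurable_funM.
    have := integral_powRD ltr01 mNd (md n.+1).
    rewrite (integral_powRZ _ (md n)) normrN normr1 powR1 mul1e invr1.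
    rewrite (@eq_integral_powR (fun x => -1 * (F n x - f x) + (F n.+1 x - f x)) (cst_sfun (-1) * F n + F n.+1 : {sfun T >-> R})); last first.
      by move=> x _; rewrite hE; ring.
    move=> /le_trans; apply.
    have p2 : (1 + 1 : R) `^ alpha <= 4.
      rewrite (_ : 4 = (1 + 1) `^ 2); last by rewrite powR_mulrn//; ring.
      by apply: ler_powR; [lra|exact: ltW].
    have h1 := (phiP n).2; have h2 := (phiP n.+1).2.
    have h2' : (N (fun x => F n.+1 x - f x) <= (8^-1 ^+ n)%:E)%E.
      apply: le_trans h2 _; rewrite lee_fin exprS ler_piMl// ?exprn_ge0//.
      lra.
    apply: (@le_trans _ _ (4%:E * (8^-1 ^+ n)%:E + 4%:E * (8^-1 ^+ n)%:E)%E); last first.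
      by rewrite -!EFinM -EFinD lee_fin; lra.
    by apply: leeD; apply: lee_pmul => //; rewrite lee_fin ?powR_ge0.
  have fN : fine (N (fun x => (cst_sfun (-1) * F n + F n.+1 : {sfun T >-> R}) x)) <= 8 * 8^-1 ^+ n.
    by rewrite -lee_fin fineK// ge0_fin_numE// (le_lt_trans Nh)// ltry.
  have pw : (2 / 2^-1 ^+ n : R) `^ alpha <= 4 * 4 ^+ n.
    apply: (@le_trans _ _ ((2 / 2^-1 ^+ n) `^ 2)).
      apply: ler_powR; last exact: ltW.
      by rewrite exprVn invrK -exprS exprn_ege1// ler1n.
    rewrite powR_mulrn ?divr_ge0// ?exprn_ge0// exprVn invrK exprMn -exprM mulnC exprM.
    by rewrite (_ : 2 ^+ 2 = 4 :> R)//; ring.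
  apply: (@le_trans _ _ (2 * (4 * 4 ^+ n) * (8 * 8^-1 ^+ n))).
    by apply: ler_pM; rewrite ?mulr_ge0 ?powR_ge0 ?fine_ge0// ler_wpM2l.
  have -> : (2 * (4 * 4 ^+ n) * (8 * 8^-1 ^+ n)) = 64 * (4 * 8^-1) ^+ n :> R.
    by rewrite exprMn; ring.
  rewrite natrX exprS (_ : 4 * 8^-1 = 2^-1 :> R); last by field.
  rewrite exprVn invfM; lra.
have [Y cY] : exists Y : {RV P >-> R}, cvg_in_probability P X Y.
  apply: cvg_in_probability_fast_cauchy.
  apply: (@le_lt_trans _ _ (\sum_(i <oo) (128 / (2 ^ i.+1)%:R)%:E)%E).
    by apply: lee_nneseries => // n _; exact: tail.
  apply: (@le_lt_trans _ _ 128%:E); last exact: ltry.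
  exact: epsilon_trick0.
exists Y, F; split => //.
apply: (@cvg_comp _ _ _ phi (fun m => N (fun x => g m x - f x)) _ \oo); last exact: cg.
move=> A [m _ mA]; exists m => // n /= mn; apply: mA => /=.
exact: leq_trans mn (phiP n).1.
Qed.

Lemma stable_integral_well_defined_Lfun f :
  measurable_fun D f -> (N f < +oo)%E ->
  stable_integral_well_defined D mu alpha M f.
Proof.
move=> mf Nf; have Lf : (f \_ D) \in Lfun mu alpha%:E by exact/restrict_LfunP.
split => //.
- by have [Y /stable_limitP fY] := stable_limit_exists mf Nf; exists Y; split.
- by move=> Y Z [_ /stable_limitP fY] [_ /stable_limitP fZ]; exact: stable_limit_unique fY fZ.
Qed.

End stable_integral.

(** * Dilations of the measure x^(-1-beta) dx *)

Section lebesgue_measure_affine.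
Context {R : realType}.
Local Notation mu := (@lebesgue_measure R).

(** The image measure multiplied by [l] agrees with Lebesgue measure on the intervals []a, b]],
    hence everywhere. *)
Lemma lebesgue_measure_dilation (l : R) (A : set (measurableTypeR R)) : 0 < l ->
  measurable A -> mu (( *%R l) @^-1` A) = ((l^-1)%:E * mu A)%E.
Proof.
move=> l0 mA.
have ml : measurable_fun setT ( *%R l : measurableTypeR R -> measurableTypeR R).
  exact: measurable_funM.
pose nu : {measure set (measurableTypeR R) -> \bar R} :=
  measure_function_pushforward__canonical__measure_function_Measure mu ml.
suff -> : mu A = mscale (NngNum (ltW l0)) nu A.
  by rewrite /mscale/= muleA -EFinM mulVf ?gt_eqF// mul1e.
apply: lebesgue_measure_unique => // _ [[a b]] _ <-.
change (mu `]a, b] = (l%:E * mu (( *%R l) @^-1` `]a, b]))%E).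
rewrite (_ : _ @^-1` _ = [set` `]a / l, b / l]]); last first.
  by apply/seteqP; split => x /=; rewrite !in_itv/= ltr_pdivrMr// ler_pdivlMr// mulrC.
rewrite !lebesgue_measure_itv/= !lte_fin ltr_pM2r ?invr_gt0//.
case: ifPn => _; last by rewrite mule0.
by rewrite -!EFinD -EFinM; congr EFin; field; rewrite gt_eqF.
Qed.

Lemma lebesgue_measure_shift (u : R) (A : set (measurableTypeR R)) :
  measurable A -> mu ((+%R u) @^-1` A) = mu A.
Proof.
move=> mA.
have ml : measurable_fun setT (+%R u : measurableTypeR R -> measurableTypeR R).
  exact: measurable_funD.
pose nu : {measure set (measurableTypeR R) -> \bar R} :=
  measure_function_pushforward__canonical__measure_function_Measure mu ml.
suff -> : mu A = nu A by [].
apply: lebesgue_measure_unique => // _ [[a b]] _ <-.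
rewrite /nu /= /pushforward.
rewrite (_ : _ @^-1` _ = [set` `]a - u, b - u]]); last first.
  by apply/seteqP; split => x /=; rewrite !in_itv/= ltrBlDl lerBrDl.
rewrite !lebesgue_measure_itv/= !lte_fin ltrD2r.
case: ifPn => _//.
by rewrite -!EFinD; congr EFin; ring.
Qed.

Lemma ge0_integral_lebesgue_shift (u : R) (D : set (measurableTypeR R))
    (f : R -> \bar R) : measurable D ->
  measurable_fun setT f -> (forall x, 0 <= f x)%E ->
  (\int[mu]_(x in D) f x = \int[mu]_(x in (+%R u) @^-1` D) f (u + x)%R)%E.
Proof.
move=> mD mf f0.
have ml : measurable_fun setT (+%R u : measurableTypeR R -> measurableTypeR R).
  exact: measurable_funD.
rewrite -[RHS](@ge0_integral_pushforward _ _ _ _ _ _ ml mu D f) => //; last exact: measurable_funTS.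
by apply: eq_measure_integral => A mA _; apply/esym; exact: lebesgue_measure_shift.
Qed.

Lemma ge0_integral_lebesgue_dilation (l : R) (D : set (measurableTypeR R))
    (f : R -> \bar R) : 0 < l -> measurable D ->
  measurable_fun setT f -> (forall x, 0 <= f x)%E ->
  (\int[mu]_(x in ( *%R l) @^-1` D) f (l * x)%R = (l^-1)%:E * \int[mu]_(x in D) f x)%E.
Proof.
move=> l0 mD mf f0.
have ml : measurable_fun setT ( *%R l : measurableTypeR R -> measurableTypeR R).
  exact: measurable_funM.
rewrite -[LHS](@ge0_integral_pushforward _ _ _ _ _ _ ml mu D f) => //; last exact: measurable_funTS.
have l'0 : 0 <= l^-1 by rewrite invr_ge0 ltW.
transitivity (\int[mscale (NngNum l'0) mu]_(x in D) f x)%E.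
  by apply: eq_measure_integral => A mA _; exact: lebesgue_measure_dilation.
by rewrite ge0_integral_mscale//; exact: measurable_funTS.
Qed.

End lebesgue_measure_affine.

Section power_measure.
Context {R : realType}.
Variable beta : R.
Local Notation mu := (@lebesgue_measure R).

(** The density satisfies [x^(-1-beta) = l^(1+beta) (l x)^(-1-beta)], and the change of variable
    contributes [l^-1]. *)
Lemma power_measure_dilation (l : R) (A : set (measurableTypeR R)) : 0 < l ->
  measurable A ->
  power_measure beta (( *%R l) @^-1` A) = ((l `^ beta)%:E * power_measure beta A)%E.
Proof.
move=> l0 mA; rewrite /power_measure.
have mp : measurable_fun setT (fun x : R => (x `^ (-1 - beta))%:E).
  by apply/measurable_EFinP; exact: measurable_powR.
rewrite (_ : _ `&` _ = ( *%R l) @^-1` (A `&` `]0, +oo[)); last first.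
  by rewrite preimage_setI; congr (_ `&` _); apply/seteqP; split => x /=;
    rewrite !in_itv/= !andbT pmulr_rgt0.
transitivity (\int[mu]_(x in ( *%R l) @^-1` (A `&` `]0%R, +oo[))
    ((l `^ (1 + beta))%:E * ((l * x) `^ (-1 - beta))%:E))%E.
  apply: eq_integral => x /[!inE]-[_] /=; rewrite in_itv/= andbT pmulr_rgt0// => x0.
  rewrite -EFinM powRM ?(ltW l0) ?(ltW x0)// mulrA -powRD; last by rewrite (gt_eqF l0) implybT.
  by rewrite (_ : 1 + beta + _ = 0) ?powRr0 ?mul1r//; ring.
rewrite (@ge0_integral_lebesgue_dilation _ l (A `&` `]0, +oo[)
  (fun x => (l `^ (1 + beta))%:E * (x `^ (-1 - beta))%:E)%E)//; last 3 first.
- exact: measurableI.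
- exact: measurable_funeM.
- by move=> x; rewrite mule_ge0// lee_fin powR_ge0.
rewrite ge0_integralZl//; last 4 first.
- exact: measurableI.
- exact: measurable_funTS.
- by move=> x _; rewrite lee_fin powR_ge0.
- by rewrite lee_fin powR_ge0.
rewrite muleA -EFinM; congr (_%:E * _)%E.
rewrite powRD; last by rewrite (gt_eqF l0) implybT.
by rewrite powRr1 ?(ltW l0)// mulrA mulVf ?gt_eqF// mul1r.
Qed.

Lemma ge0_integral_power_measure_dilation (l : R) (f : R -> \bar R) : 0 < l ->
  measurable_fun setT f -> (forall x, 0 <= f x)%E ->
  (\int[power_measure beta]_(x in `]0%R, +oo[) f (l * x)%R =
   (l `^ beta)%:E * \int[power_measure beta]_(x in `]0%R, +oo[) f x)%E.
Proof.
move=> l0 mf f0.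
have ml : measurable_fun setT ( *%R l : measurableTypeR R -> measurableTypeR R).
  exact: measurable_funM.
have dE : [set` (`]0, +oo[ : interval R)] = ( *%R l) @^-1` [set` `]0, +oo[].
  by apply/seteqP; split => x /=; rewrite !in_itv/= !andbT pmulr_rgt0.
rewrite [in LHS]dE.
rewrite -[LHS](@ge0_integral_pushforward _ _ _ _ _ _ ml (power_measure beta) `]0, +oo[ f) => //;
  last exact: measurable_funTS.
transitivity (\int[mscale (NngNum (powR_ge0 l beta)) (power_measure beta)]_(x in `]0%R, +oo[) f x)%E.
  by apply: eq_measure_integral => A mA _; exact: power_measure_dilation.
by rewrite ge0_integral_mscale//; exact: measurable_funTS.
Qed.

Lemma power_measure_itv_fin (a b : R) : 0 < a -> 0 <= 1 + beta ->
  (power_measure beta `]a, b] < +oo)%E.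
Proof.
move=> a0 b0; rewrite /power_measure.
apply: (@le_lt_trans _ _ (\int[mu]_(x in `]a, b] `&` `]0%R, +oo[) (a `^ (-1 - beta))%:E)%E).
  apply: ge0_le_integral => //.
  - exact: measurableI.
  - by move=> x _; rewrite lee_fin powR_ge0.
  - by apply/measurable_EFinP; apply: measurable_funTS; exact: measurable_powR.
  - move=> x [/=]; rewrite in_itv/= => /andP[ax _] _; rewrite lee_fin.
    rewrite -opprD !powRN lef_pV2 ?posrE ?powR_gt0//; last exact: lt_trans ax.
    by rewrite ge0_ler_powR ?nnegrE// ?(ltW a0) ?(ltW ax)// (le_trans (ltW a0)) ?(ltW ax).
rewrite integral_cst; last exact: measurableI.
rewrite lte_mul_pinfty ?lee_fin ?powR_ge0//.
apply: (@le_lt_trans _ _ (mu (`]a, b] : set R))).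
  by apply: le_measure; rewrite ?inE//; exact: measurableI.
by rewrite lebesgue_measure_itv/=; case: ifP => _; rewrite ?ltry// -EFinB ltry.
Qed.

End power_measure.

(** * Increments of g on the strip *)

(** Each layer [A n] adds at most [C q^n]; monotone convergence along the increasing [F n] passes
    the geometric bound to the union. *)
Lemma ge0_integral_bigcup_geometric {R : realType} d (T : measurableType d)
    (mu : {measure set T -> \bar R}) (F A : nat -> set T) (f : T -> \bar R)
    (C q : R) :
  F 0%N = set0 -> (forall n, F n.+1 = F n `|` A n) ->
  (forall n, F n `&` A n = set0) -> (forall n, measurable (A n)) ->
  measurable_fun setT f -> (forall x, 0 <= f x)%E -> 0 <= C -> 0 < q < 1 ->
  (forall n, \int[mu]_(x in A n) f x <= (C * q ^+ n)%:E)%E ->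
  (\int[mu]_(x in \bigcup_n F n) f x <= (C / (1 - q))%:E)%E.
Proof.
move=> F0 FS FA mA mf f0 C0 /andP[q0 q1] fA.
have mF n : measurable (F n).
  by elim: n => [|n IH]; rewrite ?F0// FS; exact: measurableU.
have ub n : (\int[mu]_(x in F n) f x <= (series (geometric C q) n)%:E)%E.
  elim: n => [|n IH]; first by rewrite F0 integral_set0 /series/= big_geq.
  rewrite FS ge0_integral_setU//; last 2 first.
  - exact: measurable_funTS.
  - by apply/eqP; rewrite FA.
  by rewrite seriesSr EFinD leeD.
have ndF : {homo F : n m / (n <= m)%N >-> (n <= m)%O}.
  apply/nondecreasing_seqP => n; rewrite subsetEset FS; exact: subsetUl.
have := @ge0_nondecreasing_set_cvg_integral _ _ _ F f mu ndF mF
  (fun n => measurable_funTS mf) (fun n x _ => f0 x).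
apply: cvge_le; apply: nearW => n; apply: (le_trans (ub n)).
by rewrite lee_fin geometric_le_lim// ger0_norm ?ltW.
Qed.

(** * Integrability against the power measure at 0 and at infinity *)

Section power_measure_bound.
Context {R : realType}.
Variable beta : R.
Hypothesis beta_gt0 : 0 < beta.
Local Notation Q := (power_measure beta).
Local Notation mR := (measurableTypeR R).

Let powR_expn (x s : R) n : 0 <= x -> (x ^+ n) `^ s = (x `^ s) ^+ n.
Proof.
move=> x0; elim: n => [|n IH]; first by rewrite !expr0 powR1.
by rewrite !exprS powRM ?exprn_ge0// IH.
Qed.

Let power_measure_fineK (a b : R) : 0 < a ->
  Q (`]a, b] : set mR) = (fine (Q (`]a, b] : set mR)))%:E.
Proof.
move=> a0; rewrite fineK// ge0_fin_numE ?measure_ge0//.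
by apply: power_measure_itv_fin => //; rewrite addr_ge0// ltW.
Qed.

(** The shell []delta 2^n, delta 2^(n+1)]] is the first one dilated by [2^n], so its mass carries
    the factor [2^(-n beta)]: a geometric series of ratio [2^-beta]. *)
Lemma integral_power_measure_tail (f : R -> \bar R) (delta K : R) :
  0 < delta -> 0 <= K -> measurable_fun setT f -> (forall x, 0 <= f x)%E ->
  (forall x : R, 0 < x -> (f x <= K%:E)%E) ->
  (\int[Q]_(x in `]delta, +oo[) f x < +oo)%E.
Proof.
move=> d0 K0 mf f0 fK.
pose F n : set mR := [set` `]delta, delta * 2 ^+ n]].
pose A n : set mR := [set` `]delta * 2 ^+ n, delta * 2 ^+ n.+1]].
have dn n : delta <= delta * 2 ^+ n.
  by rewrite ler_peMr ?(ltW d0)// exprn_ege1// ler1n.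
have dS n : delta * 2 ^+ n <= delta * 2 ^+ n.+1.
  by rewrite ler_pM2l// exprS ler_peMl// ?exprn_ge0// ler1n.
have mA n : measurable (A n) by exact: measurable_itv.
have q0 : 0 < (2^-1 : R) `^ beta < 1.
  rewrite powR_gt0 ?invr_gt0//=.
  have : (2^-1 : R) `^ beta < 1 `^ beta.
    by rewrite gt0_ltr_powR ?nnegrE ?invr_ge0// invf_lt1// ltr1n.
  by rewrite powR1.
have := @ge0_integral_bigcup_geometric _ _ _ Q F A f
  (K * fine (Q (A 0%N))) ((2^-1 : R) `^ beta).
have -> : \bigcup_n F n = [set` `]delta, +oo[].
  apply/seteqP; split => x /=.
    by case=> n _; rewrite /F/= !in_itv/= andbT => /andP[].
  rewrite in_itv/= andbT => dx.
  (* [y < 2 ^+ Num.bound y] holds for every [y]. *)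
  exists (Num.bound (x / delta)) => //; rewrite /F/= in_itv/= dx/=.
  by rewrite mulrC -ler_pdivrMr// ltW// upper_nthrootP.
move=> H; apply: (le_lt_trans (H _ _ _ _ _ _ _ _ _)) => //.
- by rewrite /F expr0 mulr1 set_itvoc0.
- move=> n; rewrite /F /A; apply/seteqP; split => x /=; rewrite !in_itv/=.
    move=> /andP[dx xn]; have [le|lt] := leP x (delta * 2 ^+ n).
      by left; rewrite dx.
    by right.
  case=> /andP[dx xn]; first by rewrite dx (le_trans xn).
  by rewrite xn (le_lt_trans (dn n) dx).
- move=> n; rewrite -subset0 => x []; rewrite /F /A/= !in_itv/= => /andP[_ a] /andP[b _].
  by rewrite ltNge a in b.
- by rewrite mulr_ge0// fine_ge0.
- move=> n.
  have An : A n = ( *%R (2 ^- n)) @^-1` A 0%N.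
    apply/seteqP; split => x; rewrite /A/= !in_itv/= expr0 mulr1 expr1 (mulrC _ x);
      rewrite ltr_pdivlMr ?exprn_gt0// ler_pdivrMr ?exprn_gt0//.
      by rewrite exprS mulrA.
    by rewrite exprS mulrA.
  apply: (@le_trans _ _ (\int[Q]_(x in A n) K%:E)%E).
    apply: ge0_le_integral => //; first exact: measurable_funTS.
    move=> x; rewrite /A/= in_itv/= => /andP[xn _]; apply: fK.
    by rewrite (lt_trans _ xn)// mulr_gt0// exprn_gt0.
  rewrite integral_cst// An.
  rewrite [X in (_ * X)%E](_ : _ = (((2 ^- n) `^ beta)%:E * Q (A 0%N))%E); last first.
    by apply: power_measure_dilation => //; rewrite invr_gt0 exprn_gt0.
  rewrite [X in (_ * (_ * X))%E](_ : _ = (fine (Q (A 0%N)))%:E); last first.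
    by apply: power_measure_fineK; rewrite expr0 mulr1.
  rewrite -!EFinM lee_fin -exprVn powR_expn ?invr_ge0//.
  by rewrite le_eqVlt; apply/orP; left; apply/eqP; ring.
- by rewrite ltry.
Qed.

(** On the shell []delta / 2^(n+1), delta / 2^n]] the mass grows like [2^(n beta)] while [f] is at
    most [C delta^r 2^(-n r)]. The ratio [2^(beta - r)] is below 1 because [beta < r]. *)
Lemma integral_power_measure_origin (f : R -> \bar R) (delta C r : R) :
  0 < delta -> 0 <= C -> beta < r -> measurable_fun setT f -> (forall x, 0 <= f x)%E ->
  (forall x : R, 0 < x -> x <= delta -> (f x <= (C * x `^ r)%:E)%E) ->
  (\int[Q]_(x in `]0%R, delta]) f x < +oo)%E.
Proof.
move=> d0 C0 br mf f0 fC.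
pose F n : set mR := [set` `]delta / 2 ^+ n, delta]].
pose A n : set mR := [set` `]delta / 2 ^+ n.+1, delta / 2 ^+ n]].
have r0 : 0 < r by exact: lt_trans br.
have p0 n : 0 < (2 ^+ n : R) by rewrite exprn_gt0.
have dn n : delta / 2 ^+ n <= delta.
  by rewrite ler_pdivrMr// ler_peMr ?(ltW d0)// exprn_ege1// ler1n.
have dS n : delta / 2 ^+ n.+1 <= delta / 2 ^+ n.
  by rewrite ler_pM2l// lef_pV2 ?posrE// exprS ler_peMl ?ltW// ltr1n.
have mA n : measurable (A n) by exact: measurable_itv.
have q0 : 0 < (2 : R) `^ (beta - r) < 1.
  rewrite powR_gt0//= -opprB powRN invf_lt1 ?powR_gt0//.
  have : (1 : R) `^ (r - beta) < 2 `^ (r - beta).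
    by rewrite gt0_ltr_powR ?nnegrE ?subr_gt0// ltr1n.
  by rewrite powR1.
have := @ge0_integral_bigcup_geometric _ _ _ Q F A f
  (C * delta `^ r * fine (Q (A 0%N))) ((2 : R) `^ (beta - r)).
have -> : \bigcup_n F n = [set` `]0, delta]].
  apply/seteqP; split => x /=.
    case=> n _; rewrite /F/= !in_itv/= => /andP[nx ->]; rewrite andbT.
    by rewrite (lt_trans _ nx)// divr_gt0.
  rewrite in_itv/= => /andP[x0 dx].
  exists (Num.bound (delta / x)) => //; rewrite /F/= in_itv/= dx andbT.
  by rewrite ltr_pdivrMr// mulrC -ltr_pdivrMr// upper_nthrootP.
move=> H; apply: (le_lt_trans (H _ _ _ _ _ _ _ _ _)) => //.
- by rewrite /F expr0 divr1 set_itvoc0.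
- move=> n; rewrite /F /A; apply/seteqP; split => x /=; rewrite !in_itv/=.
    move=> /andP[dx xn]; have [le|lt] := leP x (delta / 2 ^+ n).
      by right; rewrite dx.
    by left.
  case=> /andP[dx xn]; first by rewrite xn andbT (le_lt_trans (dS n)).
  by rewrite dx (le_trans xn).
- move=> n; rewrite -subset0 => x []; rewrite /F /A/= !in_itv/= => /andP[a _] /andP[_ b].
  by rewrite ltNge b in a.
- by rewrite !mulr_ge0 ?powR_ge0// fine_ge0.
- move=> n.
  have An : A n = ( *%R (2 ^+ n)) @^-1` A 0%N.
    apply/seteqP; split => x; rewrite /A/= !in_itv/= expr0 divr1 expr1 (mulrC _ x);
      rewrite -ltr_pdivrMr// -ler_pdivlMr//.
      by rewrite exprS invfM mulrA.
    by rewrite exprS invfM mulrA.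
  apply: (@le_trans _ _ (\int[Q]_(x in A n) (C * (delta / 2 ^+ n) `^ r)%:E)%E).
    apply: ge0_le_integral => //; first exact: measurable_funTS.
    move=> x; rewrite /A/= in_itv/= => /andP[nx xn].
    have x0 : 0 < x by rewrite (lt_trans _ nx)// divr_gt0.
    apply: (le_trans (fC x x0 (le_trans xn (dn n)))).
    have y0 : 0 <= delta / 2 ^+ n by rewrite ltW// divr_gt0.
    by rewrite lee_fin ler_wpM2l// ge0_ler_powR ?nnegrE ?(ltW r0) ?(ltW x0).
  rewrite integral_cst// An.
  rewrite [X in (_ * X)%E](_ : _ = (((2 ^+ n) `^ beta)%:E * Q (A 0%N))%E); last first.
    by apply: power_measure_dilation.
  rewrite [X in (_ * (_ * X))%E](_ : _ = (fine (Q (A 0%N)))%:E); last first.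
    by apply: power_measure_fineK; rewrite divr_gt0.
  rewrite -!EFinM lee_fin powRM ?(ltW d0) ?invr_ge0 ?(ltW (p0 n))//.
  rewrite -powR_inv1 ?(ltW (p0 n))// -powRrM mulN1r !powR_expn//.
  rewrite powRD; last by rewrite pnatr_eq0 implybT.
  by rewrite exprMn le_eqVlt; apply/orP; left; apply/eqP; ring.
- by rewrite ltry.
Qed.

Lemma integral_power_measure_lty (f : R -> \bar R) (delta C K r : R) :
  0 < delta -> 0 <= C -> 0 <= K -> beta < r ->
  measurable_fun setT f -> (forall x, 0 <= f x)%E ->
  (forall x : R, 0 < x -> x <= delta -> (f x <= (C * x `^ r)%:E)%E) ->
  (forall x : R, 0 < x -> (f x <= K%:E)%E) ->
  (\int[Q]_(x in `]0%R, +oo[) f x < +oo)%E.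
Proof.
move=> d0 C0 K0 br mf f0 fC fK.
rewrite (@itv_bndbnd_setU _ _ _ (BRight delta)) ?bnd_simp ?ltW//.
rewrite ge0_integral_setU//; last 2 first.
- exact: measurable_funTS.
- apply/eqP; rewrite -subset0 => x [] /=; rewrite !in_itv/= andbT => /andP[_ a].
  by rewrite ltNge a.
rewrite lte_add_pinfty//; first exact: (@integral_power_measure_origin f delta C r).
exact: (@integral_power_measure_tail f delta K).
Qed.

End power_measure_bound.

(** * Translates and increments of a periodic function *)

Section periodic.
Context {R : realType}.
Variables (alpha : R) (g : R -> R).
Hypothesis alpha_gt0 : 0 < alpha.
Hypothesis g_periodic : periodic g (2 * pi).
Hypothesis gL : (g \_ `[0, 2 * pi[) \in Lfun (@lebesgue_measure R) alpha%:E.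
Local Notation mu := (@lebesgue_measure R).
Local Notation mR := (measurableTypeR R).
Local Notation p := (2 * pi : R).
Local Notation N f := (modular (`[0%R, p[ : set mR) mu alpha (f : mR -> R)).

Let p0 : 0 < p. Proof. by rewrite mulr_gt0// pi_gt0. Qed.

Lemma periodic_int (x : R) (m : int) : g (x + p * m%:~R) = g x.
Proof.
case: m => n.
  by rewrite -pmulrn mulr_natr periodicn.
rewrite NegzE -(periodicn g_periodic n.+1); congr g.
by rewrite -[p *+ _]mulr_natr; ring.
Qed.

Let frac (x : R) := x - p * Rfloor (x / p).

Let g_frac x : g (frac x) = g x.
Proof. by rewrite /frac RfloorE -mulrN -mulrNz periodic_int. Qed.

Let frac_itv x : 0 <= frac x < p.
Proof.
rewrite /frac subr_ge0 ltrBlDr mulrC -ler_pdivlMr// Rfloor_le/=.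
have := lt_succ_Rfloor (x / p).
by rewrite ltr_pdivrMr// mulrDl mul1r addrC.
Qed.

Let mfrac : measurable_fun setT (frac : mR -> mR).
Proof.
apply: measurable_funB => //; apply: measurable_funM => //.
apply: measurableT_comp => //; last exact: measurable_funM.
by apply: nondecreasing_measurable => // a b; exact: le_Rfloor.
Qed.

Let gLP := (restrict_LfunP mu (measurable_itv `[0, p[) alpha_gt0 g).1 gL.

(** [gL] speaks of one period only; [g] is its restriction to that period composed with the Borel
    map [frac]. *)
Lemma periodic_measurable : measurable_fun setT (g : mR -> R).
Proof.
have mg0 := (measurable_restrictT _ (measurable_itv `[0, p[)).1 gLP.1.
rewrite (_ : g = (g \_ `[0, p[) \o frac); first exact: measurableT_comp.
apply/funext => x /=; rewrite patchE mem_set ?g_frac//=.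
by rewrite in_itv/= frac_itv.
Qed.

Let G x := (`|g x| `^ alpha)%:E.

Let mG : measurable_fun setT (G : mR -> \bar R).
Proof.
apply/measurable_EFinP; apply: (measurableT_comp (measurable_powR alpha)).
by apply: measurableT_comp periodic_measurable.
Qed.

Let G0 x : (0 <= G x)%E. Proof. by rewrite lee_fin powR_ge0. Qed.

(** The shift [u] is reduced modulo the period to [v] in [[0, 2 pi[]. The window [[v, v + 2 pi[]
    then lies in two consecutive periods, whence the factor 2; a uniform bound is all that is
    wanted. *)
Lemma modular_translate (u : R) : (N (fun s => g (s + u)%R) <= 2%:E * N g)%E.
Proof.
have uE s : g (s + u) = g (frac u + s).
  by rewrite /frac RfloorE -(periodic_int (s + u) (- Num.floor (u / p))); congr g; rewrite mulrNz; ring.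
rewrite !modularE.
have /andP[v0 vp] := frac_itv u.
set v := frac u in uE v0 vp.
have E : [set` `[0, p[] = (+%R v) @^-1` [set` `[v, v + p[].
  by apply/seteqP; split => x /=; rewrite !in_itv/= lerDl ltrD2l.
have E' : [set` `[0, p[] = (+%R p) @^-1` [set` `[p, p + p[].
  by apply/seteqP; split => x /=; rewrite !in_itv/= lerDl ltrD2l.
under eq_integral do rewrite uE.
rewrite [X in (X <= _)%E](_ : _ = \int[mu]_(x in (+%R v) @^-1` [set` `[v, (v + p)%R[]) G (v + x)%R)%E; last by rewrite -E.
rewrite -(@ge0_integral_lebesgue_shift _ v _ G)//.
have vI : (\int[mu]_(x in `[v, (v + p)%R[) G x <= \int[mu]_(x in `[0%R, (p + p)%R[) G x)%E.
  apply: ge0_subset_integral => //; first exact: measurable_funTS.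
  move=> x /=; rewrite !in_itv/= => /andP[vx xv].
  by rewrite (le_trans v0 vx)/= (lt_le_trans xv)// lerD2r ltW.
apply: (le_trans vI).
rewrite (@itv_bndbnd_setU _ _ _ (BLeft p)) ?bnd_simp ?(ltW p0) ?lerDl ?(ltW p0)//.
rewrite ge0_integral_setU//; last 2 first.
- exact: measurable_funTS.
- apply/eqP; rewrite -subset0 => x [] /=; rewrite !in_itv/= => /andP[_ a] /andP[b _].
  by rewrite ltNge b in a.
rewrite [X in (_ + X)%E](@ge0_integral_lebesgue_shift _ p _ G)// -E'.
rewrite [X in (_ + X)%E](_ : _ = \int[mu]_(x in `[0%R, p[) G x)%E; last first.
  by apply: eq_integral => x _; rewrite /G addrC g_periodic.
by rewrite mule_natl mule2n.
Qed.

Lemma modular_increment_bounded : exists2 K : R, 0 <= K &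
  forall u : R, (N (fun s => g (s + u) - g s)%R <= K%:E)%E.
Proof.
have [mg Ng] := gLP.
have N0 f : (0 <= N f)%E.
  by rewrite modularE; apply: integral_ge0 => x _; rewrite lee_fin powR_ge0.
pose c := fine (N g).
have cE : N g = c%:E by rewrite fineK// ge0_fin_numE.
exists (2 `^ alpha * (2 * c) + 2 `^ alpha * c).
  by rewrite addr_ge0// !mulr_ge0 ?powR_ge0// fine_ge0.
move=> u.
have mgu : measurable_fun (`[0, p[ : set mR) (fun s : mR => g (s + u)).
  apply: measurable_funTS.
  by apply: (measurableT_comp periodic_measurable); exact: measurable_funD.
have mpi : measurable (`[0, p[ : set mR) by exact: measurable_itv.
have := @integral_powRD _ _ _ _ mu alpha mpi alpha_gt0 1
  (fun s => g (s + u)) (fun s => -1 * g s) ltr01 mgu (measurable_funM (measurable_cst _) mg).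
rewrite integral_powRZ// normrN1 powR1 mul1e invr1.
rewrite (_ : (fun s : mR => g (s + u) + -1 * g s) = (fun s => g (s + u) - g s)); last first.
  by apply/funext => s; rewrite mulN1r.
move=> /le_trans; apply.
rewrite [in leRHS]EFinD leeD//; last by rewrite cE -EFinM.
rewrite EFinM lee_pmul ?lee_fin ?powR_ge0//.
by rewrite EFinM -cE; exact: modular_translate.
Qed.

End periodic.

(** * Tonelli on the strip and the modular of an increment *)

Section strip.
Context {R : realType}.
Variable beta : R.
Hypothesis beta_gt0 : 0 < beta.
Local Notation mu := (@lebesgue_measure R).
Local Notation mR := (measurableTypeR R).
Local Notation p := (2 * pi : R).
Local Notation Q := (power_measure beta).

Lemma measurable_strip : measurable (@strip R).
Proof. by apply: measurableX; exact: measurable_itv. Qed.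

Section tonelli.
Variable h : mR * mR -> \bar R.
Hypothesis mh : measurable_fun setT h.
Hypothesis h0 : forall z, (0 <= h z)%E.

Lemma measurable_strip_section :
  measurable_fun setT (fun x : mR => \int[mu]_(s in `[0%R, p[) h (s, x))%E.
Proof.
pose D : set (mR * mR) := [set` `[0, p[] `*` setT.
have mD : measurable D by apply: measurableX => //; exact: measurable_itv.
have mhD := (measurable_restrictT h mD).1 (measurable_funTS mh).
have hD0 z : (0 <= (h \_ D) z)%E by rewrite patchE; case: ifP.
have := @measurable_fun_fubini_tonelli_G _ _ _ _ R mu (h \_ D) mhD hD0.
congr measurable_fun; apply/funext => x; rewrite /fubini_G [RHS]integral_mkcond.
apply: eq_integral => s _; rewrite !patchE /D.
by congr (if _ then _ else _); apply/idP/idP; rewrite !inE/=; tauto.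
Qed.

Lemma integral_strip :
  (\int[strip_measure beta]_(z in strip) h z =
   \int[Q]_(x in `]0%R, +oo[) \int[mu]_(s in `[0%R, p[) h (s, x))%E.
Proof.
have ms := measurable_strip.
have mhD := (measurable_restrictT h ms).1 (measurable_funTS mh).
have hD0 z : (0 <= (h \_ strip) z)%E by rewrite patchE; case: ifP.
rewrite integral_mkcond /strip_measure fubini_tonelli2//.
rewrite [RHS]integral_mkcond; apply: eq_integral => x _.
rewrite /fubini_G patchE; case: ifPn => [|/negP]; rewrite inE => x0.
  rewrite [RHS]integral_mkcond; apply: eq_integral => s _; rewrite !patchE.
  by congr (if _ then _ else _); apply/idP/idP; rewrite !inE/strip/=; tauto.
rewrite (eq_integral (cst 0%E)) ?integral0// => s _.
by rewrite patchE memNset// /strip/= => -[].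
Qed.

End tonelli.

Variable alpha : R.
Hypothesis alpha_gt0 : 0 < alpha.
Local Notation N f := (modular strip (strip_measure beta) alpha f%R).

Let mpow (F : mR * mR -> R) : measurable_fun setT F ->
  measurable_fun setT (fun z => (`|F z| `^ alpha)%:E).
Proof.
move=> mF; apply/measurable_EFinP; apply: (measurableT_comp (measurable_powR alpha)).
by apply: measurableT_comp mF.
Qed.

(** The integral over [s] is unaffected, and the outer integral over [x] scales by the dilation rule
    for Q. *)
Lemma modular_strip_dilation (l : R) (F : mR * mR -> R) : 0 < l ->
  measurable_fun setT F ->
  N (fun z => F (z.1, l * z.2)) = ((l `^ beta)%:E * N F)%E.
Proof.
move=> l0 mF; rewrite !modularE.
have mFl : measurable_fun setT (fun z : mR * mR => F (z.1, l * z.2)).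
  apply: (measurableT_comp mF); apply/measurable_fun_pairP; split => /=.
    exact: measurable_fst.
  by apply: measurable_funM => //; exact: measurable_snd.
have F0 G (z : mR * mR) : (0 <= (`|G z : R| `^ alpha)%:E)%E by rewrite lee_fin powR_ge0.
rewrite integral_strip//; last exact: mpow.
rewrite integral_strip//; last exact: mpow.
rewrite -(ge0_integral_power_measure_dilation beta l0)//.
  exact: (measurable_strip_section (mpow mF)).
by move=> x; exact: integral_ge0.
Qed.

Variables (r : R) (g : R -> R).
Hypothesis g_periodic : periodic g p.
Hypothesis gL : (g \_ `[0, p[) \in Lfun mu alpha%:E.
Hypothesis beta_lt_r : beta < r.
Hypothesis g_incr : (fun t : R => \int[mu]_(s in `[0%R, p[) (`|g (s + t) - g s| `^ alpha))
            =O_ ((0 : R)^') (fun t : R => `|t| `^ r).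

Lemma measurable_increment (t : R) : measurable_fun setT (increment g t).
Proof.
have mg := periodic_measurable alpha_gt0 g_periodic gL.
apply: measurable_funB; last exact: measurableT_comp measurable_fst.
apply: (measurableT_comp mg); apply: measurable_funD; first exact: measurable_fst.
by apply: measurable_funM => //; exact: measurable_snd.
Qed.

Lemma modular_increment_lty (t : R) : (N (increment g t) < +oo)%E.
Proof.
have [K K0 PhiK] := modular_increment_bounded alpha_gt0 g_periodic gL.
pose Phi u : \bar R := (\int[mu]_(s in `[0%R, p[) (`|g (s + u) - g s| `^ alpha)%:E)%E.
have PhiD u : Phi u = (\int[mu]_(s in `[0%R, p[) (`|g (s + u) - g s| `^ alpha)%:E)%E by [].
have {}PhiK u : (Phi u <= K%:E)%E by have := PhiK u; rewrite modularE.
have Phi0 u : (0 <= Phi u)%E by apply: integral_ge0 => x _; rewrite lee_fin powR_ge0.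
have mh := mpow (measurable_increment t).
have h0 (z : mR * mR) : (0 <= (`|increment g t z| `^ alpha)%:E)%E.
  by rewrite lee_fin powR_ge0.
rewrite modularE integral_strip//.
have PhiE (x : mR) :
    (\int[mu]_(s in `[0%R, p[) (`|increment g t (s, x)| `^ alpha)%:E)%E = Phi (t * x)%R by [].
have mK := measurable_strip_section mh h0.
under eq_integral do rewrite PhiE.
rewrite (_ : (fun x : mR => _) = (fun x => Phi (t * x)%R)) in mK; last first.
  by apply/funext => x; rewrite PhiE.
clearbody Phi.
suff [delta [C [d0 C0 PhiC]]] : exists delta C, [/\ 0 < delta, 0 <= C &
    forall x : R, 0 < x -> x <= delta -> (Phi (t * x)%R <= (C * x `^ r)%:E)%E].
  exact: (@integral_power_measure_lty _ beta beta_gt0 _ delta C K r).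
(* [g_incr] concerns a punctured neighbourhood of 0, so [t = 0] is separate; there [Phi]
   vanishes. *)
have [->|t0] := eqVneq t 0.
  exists 1, 0; split => // x _ _; rewrite mul0r mul0r PhiD.
  rewrite (eq_integral (cst 0%E)) ?integral0// => s _.
  by rewrite addr0 subrr normr0 powR0// gt_eqF.
have /eqO_exP[k k0 near0] := g_incr.
have [e /= e0 ek] := near0.
(* For such [x] one has [|t x| <= e / 2 < e], and [|t x|^r = |t|^r x^r] puts [|t|^r] into the
   constant. *)
exists (e / (2 * `|t|)), (k * `|t| `^ r); split.
- by rewrite divr_gt0// mulr_gt0// normr_gt0.
- by rewrite mulr_ge0 ?powR_ge0// ltW.
move=> x x0 xe.
have tx0 : t * x != 0 by rewrite mulf_neq0// gt_eqF.
have := ek (t * x).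
rewrite /ball_/= sub0r normrN normrM (gtr0_norm x0) => /(_ _ tx0).
have te : `|t| * x < e.
  move: xe; rewrite ler_pdivlMr ?mulr_gt0 ?normr_gt0// => xe.
  rewrite (lt_le_trans _ xe)// mulrC ltr_pM2l// ltr_pMl ?normr_gt0// ltr1n//.
move=> /(_ te) /(le_trans (ler_norm _)).
rewrite (ger0_norm (powR_ge0 _ _)) powRM// ?(ltW x0)// mulrA => H.
(* [g_incr] bounds a real-valued integral, which would be 0 were the extended one infinite; the
   uniform bound [PhiK] rules this out. *)
rewrite -[leLHS]fineK; first by rewrite PhiD lee_fin.
by rewrite ge0_fin_numE//; exact: le_lt_trans (PhiK _) (ltry _).
Qed.

End strip.

(** * Self-similarity *)

Section stable_limit_sum.
Context {R : realType} d (Omega : measurableType d) (P : probability Omega R).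
Context d' (T : measurableType d') (D : set T) (mu : {measure set T -> \bar R}).
Variable alpha : R.
Hypothesis mD : measurable D.
Hypothesis alpha_gt0 : 0 < alpha.
Hypothesis alpha_lt2 : alpha < 2.
Variable M : set T -> {RV P >-> R}.
Hypothesis M_SaS : SaS_random_measure D mu alpha M.

(** A linear combination of integrals is itself a stable integral, so its law is determined by one
    modular; this gives the joint characteristic function. *)
Lemma stable_limit_sum n (theta : 'I_n -> R) (f : 'I_n -> T -> R)
    (Y : 'I_n -> {RV P >-> R}) (W : {RV P >-> R}) :
  (forall i, measurable_fun D (f i)) ->
  (forall i, modular D mu alpha (f i) < +oo)%E ->
  (forall i, stable_limit D mu alpha M (f i) (Y i)) ->
  (forall w, W w = \sum_(i < n) theta i * Y i w) ->
  [/\ measurable_fun D (fun x => \sum_(i < n) theta i * f i x),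
      (modular D mu alpha (fun x => (\sum_(i < n) theta i * f i x)%R) < +oo)%E &
      stable_limit D mu alpha M (fun x => \sum_(i < n) theta i * f i x) W].
Proof.
elim: n theta f Y W => [|n IH] theta f Y W mf Nf fY WE.
  (* The empty sum is written as [-1 * 0 + 0] to apply linearity to any integral [Z] of zero: the
     variable [- Z + Z] is exactly 0. *)
  have -> : (fun x : T => \sum_(i < 0) theta i * f i x) = (fun x => -1 * 0 + 0).
    by apply/funext => x; rewrite big_ord0 mulr0 addr0.
  have m0 : measurable_fun D (fun _ : T => 0 : R) by exact: measurable_cst.
  have N0 : modular D mu alpha (fun _ : T => 0%R) = 0%E.
    by rewrite modularE; apply: integral0_eq => x _; rewrite normr0 powR0// gt_eqF.
  have [Z cZ] := stable_limit_exists mD alpha_gt0 alpha_lt2 M_SaS m0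
    (eq_ind_r (fun u => u < +oo)%E (ltry 0) N0).
  split.
  - exact: measurable_cst.
  - by rewrite mulr0 addr0 N0 ltry.
  - apply: (@stable_limit_linear _ _ _ _ _ _ _ _ _ mD alpha_gt0 M M_SaS (-1)
      (fun=> 0) (fun=> 0) Z Z W) => //.
    by move=> w; rewrite WE big_ord0 mulN1r addNr.
have mW' : measurable_fun setT (fun w => \sum_(i < n) theta (widen_ord (leqnSn n) i) *
    Y (widen_ord (leqnSn n) i) w).
  by apply: measurable_sum => i; apply: measurable_funM.
have [mF NF FW] := IH (fun i => theta (widen_ord (leqnSn n) i))
  (fun i => f (widen_ord (leqnSn n) i)) (fun i => Y (widen_ord (leqnSn n) i)) (mk_RV P mW')
  (fun i => mf _) (fun i => Nf _) (fun i => fY _) (fun _ => erefl).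
have FE : (fun x : T => \sum_(i < n.+1) theta i * f i x) =
    (fun x => theta ord_max * f ord_max x + \sum_(i < n) theta (widen_ord (leqnSn n) i) *
      f (widen_ord (leqnSn n) i) x).
  by apply/funext => x; rewrite big_ord_recr/= addrC.
rewrite FE; split.
- by apply: measurable_funD => //; apply: measurable_funM.
- exact: integral_powR_linear_fin.
- apply: (@stable_limit_linear _ _ _ _ _ _ _ _ _ mD alpha_gt0 M M_SaS (theta ord_max) _ _
    (Y ord_max) (mk_RV P mW') W) => //.
  by move=> w; rewrite WE big_ord_recr/= addrC.
Qed.

End stable_limit_sum.

Theorem proposition4p13 (R : realType) (d : measure_display)
  (Omega : measurableType d) (P : probability Omega R)
  (alpha beta r : R) (g : R -> R)
  (alpha_gt0 : 0 < alpha) (alpha_lt2 : alpha < 2) (beta_gt0 : 0 < beta)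
  (gL : (g \_ `[0, 2 * pi[) \in Lfun (@lebesgue_measure R) alpha%:E)
  (g_periodic : periodic g (2 * pi))
  (beta_lt_r : beta < r)
  (g_incr : (fun t : R => \int[lebesgue_measure]_(s in `[0%R, 2 * pi[)
                            (`|g (s + t) - g s| `^ alpha))
            =O_ ((0 : R)^') (fun t : R => `|t| `^ r))
  (M : set (measurableTypeR R * measurableTypeR R) -> {RV P >-> R})
  (M_SaS : SaS_random_measure strip (strip_measure beta) alpha M) :
  (forall t : R, stable_integral_well_defined
                   strip (strip_measure beta) alpha M (increment g t)) /\
  (forall X : R -> {RV P >-> R},
     (forall t, is_stable_integral
                  strip (strip_measure beta) alpha M (increment g t) (X t)) ->
     self_similar P (beta / alpha) X).
Proof.
have ms := @measurable_strip R.
have mi t := measurable_increment alpha_gt0 g_periodic gL t.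
have ms_i t : measurable_fun strip (increment g t) by exact: measurable_funTS.
have Ni t := modular_increment_lty beta_gt0 alpha_gt0 g_periodic gL beta_lt_r g_incr t.
split=> [t|X Xi lambda l0 n t B mB].
  exact: (stable_integral_well_defined_Lfun ms alpha_gt0 alpha_lt2 M_SaS).
have cX t' : stable_limit strip (strip_measure beta) alpha M (increment g t') (X t').
  by have [_ /stable_limitP] := Xi t'.
set H := beta / alpha.
have mT (Z : 'I_n -> Omega -> R) : (forall i, measurable_fun setT (Z i)) ->
    measurable_fun setT (fun w => [tuple Z i w | i < n]).
  move=> mZ; apply/measurable_fun_tnthP => i.
  by rewrite (_ : _ \o _ = Z i)//; apply/funext => w /=; rewrite tnth_mktuple.
have mS (theta : 'I_n -> R) (s : 'I_n -> R) :
    measurable_fun setT (fun w => \sum_(i < n) theta i * X (s i) w).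
  by apply: measurable_sum => i; apply: measurable_funM.
have lim (theta s : 'I_n -> R) := stable_limit_sum ms alpha_gt0 alpha_lt2 M_SaS
  (W := mk_RV P (mS theta s)) (fun i => ms_i (s i)) (fun i => Ni (s i)) (fun i => cX (s i))
  (fun _ => erefl).
have same (theta : 'I_n -> R) :
   (\int[P]_w cos (\sum_(i < n) theta i * X (lambda * tnth t i) w) =
    \int[P]_w cos (lambda `^ H * \sum_(i < n) theta i * X (tnth t i) w))%R /\
   (\int[P]_w sin (\sum_(i < n) theta i * X (lambda * tnth t i) w) =
    \int[P]_w sin (lambda `^ H * \sum_(i < n) theta i * X (tnth t i) w))%R.
  have [m1 N1 /(stable_limit_SaS ms alpha_gt0 alpha_lt2 M_SaS m1 N1) /SaSP S1] :=
    lim theta (fun i => lambda * tnth t i).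
  have [m0 N0 /(stable_limit_SaS ms alpha_gt0 alpha_lt2 M_SaS m0 N0) /SaSP S0] :=
    lim theta (tnth t).
  (* The factor [lambda^H] is moved into the argument of the characteristic function, where
     [(lambda^H)^alpha = lambda^beta]. *)
  have [S1c S1s] := S1 1; have [S0c S0s] := S0 (lambda `^ H).
  have one (h : R -> R) : (\int[P]_w h (1 * \sum_(i < n) theta i * X (lambda * tnth t i) w) =
      \int[P]_w h (\sum_(i < n) theta i * X (lambda * tnth t i) w))%R.
    by apply: eq_Rintegral => w _; rewrite mul1r.
  rewrite -!one S1c S1s S0c S0s; split => //; congr (expR (- _)).
  rewrite normr1 powR1 mul1r ger0_norm ?powR_ge0// -powRrM /H divfK ?gt_eqF//.
  (* The increment at time [lambda t] is the increment at time [t] with [x] replaced by [lambda x],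
     simultaneously for all times in the combination. *)
  rewrite (_ : modular _ _ _ _ = ((lambda `^ beta)%:E * modular strip (strip_measure beta) alpha
    (fun z => (\sum_(i < n) theta i * increment g (tnth t i) z)%R))%E); last first.
    rewrite -modular_strip_dilation//; last first.
      by apply: measurable_sum => i; apply: measurable_funM.
    congr (modular _ _ _ _); apply/funext => z; apply: eq_bigr => i _.
    by rewrite /increment/= mulrA (mulrC (tnth t i)).
  rewrite fineM//= ge0_fin_numE//.
  by rewrite modularE; apply: integral_ge0 => x _; rewrite lee_fin powR_ge0.
have lE theta (w : Omega) : linear_form theta [tuple X (lambda * tnth t i) w | i < n] =
    \sum_(i < n) theta i * X (lambda * tnth t i) w.
  by apply: eq_bigr => i _; rewrite tnth_mktuple.
have lE' theta (w : Omega) : linear_form theta [tuple lambda `^ H * X (tnth t i) w | i < n] =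
    lambda `^ H * \sum_(i < n) theta i * X (tnth t i) w.
  by rewrite mulr_sumr; apply: eq_bigr => i _; rewrite tnth_mktuple mulrCA.
rewrite /finite_dim_distribution /pushforward.
apply: charfun_unique => //.
- exact: mT.
- by apply: mT => i; apply: measurable_funM.
- move=> theta.
  transitivity (\int[P]_w cos (\sum_(i < n) theta i * X (lambda * tnth t i) w))%R.
    by apply: eq_Rintegral => w _; rewrite lE.
  by rewrite (same theta).1; apply: eq_Rintegral => w _; rewrite lE'.
- move=> theta.
  transitivity (\int[P]_w sin (\sum_(i < n) theta i * X (lambda * tnth t i) w))%R.
    by apply: eq_Rintegral => w _; rewrite lE.
  by rewrite (same theta).2; apply: eq_Rintegral => w _; rewrite lE'.
Qed.
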